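(* Let $n\ge 2$. The following statements are valid. (i) For every $f\in\mathscr H^2(\triangle^n_0)$ (the space $\mathscr H^2_m(\triangle^n_0)$ with $m=(1,\ldots,1)$), $$\|f\|^2=\sup_{t_1,\ldots,t_n\in(0,1)}\int_{[0,2\pi]^n}\Big|f\Big(\prod_{j=1}^n t_j\,e^{i\theta_1},\ \prod_{j=2}^n t_j\,e^{i\theta_2},\ \ldots,\ t_ne^{i\theta_n}\Big)\Big|^2\ \prod_{j=1}^n t_j^{2j-1}\,\frac{d\theta}{(2\pi)^n},$$ where $d\theta$ is Lebesgue measure on $[0,2\pi]^n$. (ii) If $m=(m_1,\ldots,m_n)\in\mathbb N^n$ satisfies $m_j\ge 2$ for every $j=1,\ldots,n$, then $\mathscr H^2_m(\triangle^n_0)$ is embedded isometrically into $L^2(\triangle^n_0,w(z)\,dz)$, where the weight is $$w(z)=\frac1{\pi^n}\Big(\prod_{j=1}^{n-1}(m_j-1)\Big(1-\frac{|z_j|^2}{|z_{j+1}|^2}\Big)^{m_j-2}\Big)(m_n-1)(1-|z_n|^2)^{m_n-2},\qquad z\in\triangle^n_0.$$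
   Context: The $n$-dimensional Hartogs triangle is $\triangle^n_0=\{z\in\mathbb C^n:|z_1|<|z_2|<\cdots<|z_n|<1\}$. For $m=(m_1,\ldots,m_n)\in\mathbb N^n$ ($\mathbb N$ = positive integers), $\mathscr H^2_m(\triangle^n_0)$ is the reproducing kernel Hilbert space of holomorphic functions on $\triangle^n_0$ with the positive semi-definite reproducing kernel $$\prod_{j=2}^n\frac1{z_j\overline w_j}\Big(\prod_{j=1}^{n-1}\frac{1}{\big(1-\frac{z_j\overline w_j}{z_{j+1}\overline w_{j+1}}\big)^{m_j}}\Big)\frac1{(1-z_n\overline w_n)^{m_n}},\qquad z,w\in\triangle^n_0.$$ When $m_j=1$ for all $j$ this space is denoted $\mathscr H^2(\triangle^n_0)$. In (ii), $dz$ is Lebesgue (volume) measure on $\mathbb C^n$, and the embedding is the inclusion of functions. *)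

(* Defs.v *)
From HB Require Import structures.
From mathcomp Require Import all_boot all_order all_algebra.
From mathcomp Require Import complex.
From mathcomp Require Import all_classical all_reals all_analysis.

Set Implicit Arguments.
Unset Strict Implicit.
Unset Printing Implicit Defensive.

Import Order.TTheory GRing.Theory Num.Theory.
Import numFieldNormedType.Exports.

Local Open Scope classical_set_scope.
Local Open Scope ring_scope.

Local Notation normc := Normc.normc.

(* [m1 \x m2] only carries a canonical sigma-finite structure when [m1] and
   [m2] are (sub)probabilities, hence this alias. *)
Section sigma_finite_product.
Local Open Scope ereal_scope.
Context d1 d2 (T1 : measurableType d1) (T2 : measurableType d2) (R : realType).
Context (m1 : {sigma_finite_measure set T1 -> \bar R}).
Context (m2 : {sigma_finite_measure set T2 -> \bar R}).

Definition sf_product : set (T1 * T2) -> \bar R := m1 \x m2.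

HB.instance Definition _ := Measure.on sf_product.

Lemma sf_product_sigma_finite : sigma_finite setT sf_product.
Proof.
have /sigma_finiteP[F [TF ndF Foo]] := sigma_finiteT m1.
have /sigma_finiteP[G [TG ndG Goo]] := sigma_finiteT m2.
exists (fun n => F n `*` G n).
  rewrite -setXTT TF TG predeqE => -[x y]; split.
    move=> [/= [n _ Fnx] [k _ Gky]]; exists (maxn n k) => //; split.
    - by move: x Fnx; exact/subsetPset/ndF/leq_maxl.
    - by move: y Gky; exact/subsetPset/ndG/leq_maxr.
  by move=> [n _ []/= ? ?]; split; exists n.
move=> k; have [? ?] := Foo k; have [? ?] := Goo k.
split; first exact: measurableX.
by rewrite /sf_product product_measure1E// lte_mul_pinfty// ge0_fin_numE.
Qed.

HB.instance Definition _ := Measure_isSigmaFinite.Build _ _ _ sf_product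
  sf_product_sigma_finite.

End sigma_finite_product.

Section cons_measure.
Local Open Scope ereal_scope.
Context d (T : measurableType d) (R : realType).
Context (mu : {sigma_finite_measure set T -> \bar R}) (n : nat).
Context (nu : {sigma_finite_measure set (n.-tuple T) -> \bar R}).

Definition tcons (x : T * n.-tuple T) : n.+1.-tuple T :=
  [tuple of x.1 :: x.2].

Lemma measurable_tcons : measurable_fun setT tcons.
Proof. exact: measurable_cons. Qed.

Definition cons_measure : set (n.+1.-tuple T) -> \bar R :=
  pushforward (sf_product mu nu) tcons.

Let cons_measure0 : cons_measure set0 = 0.
Proof. by rewrite /cons_measure /pushforward preimage_set0 measure0. Qed.

Let cons_measure_ge0 A : 0 <= cons_measure A.
Proof. by rewrite /cons_measure /pushforward measure_ge0. Qed.

Let cons_measure_sigma_additive : semi_sigma_additive cons_measure.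
Proof.
move=> F mF tF mUF; rewrite /cons_measure /pushforward preimage_bigcup.
have mpre A : measurable A -> measurable (tcons @^-1` A).
  by move=> mA; rewrite -[X in measurable X]setTI; exact: measurable_tcons.
apply: measure_semi_sigma_additive.
- by move=> k; exact: mpre.
- apply/trivIsetP => /= i j _ _ ij; rewrite -preimage_setI.
  by move/trivIsetP : tF => /(_ _ _ _ _ ij) ->//; rewrite preimage_set0.
- by rewrite -preimage_bigcup; exact: mpre.
Qed.

HB.instance Definition _ := isMeasure.Build _ _ _ cons_measure
  cons_measure0 cons_measure_ge0 cons_measure_sigma_additive.

Let cons_measure_sigma_finite : sigma_finite setT cons_measure.
Proof.
have /sigma_finiteP[F [TF ndF Foo]] := sigma_finiteT (sf_product mu nu).
pose g (t : n.+1.-tuple T) : T * n.-tuple T := (thead t, [tuple of behead t]).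
have gK x : g (tcons x) = x.
  by case: x => a b; rewrite /g /tcons/=; congr pair; apply/val_inj.
have mg : measurable_fun setT g.
  apply/measurable_fun_pair; last exact: measurable_behead.
  exact: (@measurable_tnth _ _ _ ord0).
exists (fun k => g @^-1` F k).
  rewrite -preimage_bigcup -TF preimage_setT//.
move=> k; have [mFk Fk] := Foo k; split.
  by rewrite -[X in measurable X]setTI; exact: mg.
rewrite /cons_measure /pushforward -comp_preimage.
by rewrite (_ : g \o tcons = id)//; apply/funext => x; exact: gK.
Qed.

HB.instance Definition _ := Measure_isSigmaFinite.Build _ _ _ cons_measure
  cons_measure_sigma_finite.

End cons_measure.

Fixpoint tuple_measure d (T : measurableType d) (R : realType)
    (mu : {sigma_finite_measure set T -> \bar R}) (n : nat) :
    {sigma_finite_measure set (n.-tuple T) -> \bar R} :=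
  if n is n'.+1 then cons_measure mu (tuple_measure mu n')
  else @dirac _ (0.-tuple T) [tuple] R.

Lemma tuple_measure_box d (T : measurableType d) (R : realType)
    (mu : {sigma_finite_measure set T -> \bar R}) (n : nat)
    (A : 'I_n -> set T) : (forall i, measurable (A i)) ->
  tuple_measure mu n [set t | forall i, A i (tnth t i)] =
  (\prod_(i < n) mu (A i))%E.
Proof.
elim: n A => [|n IH] A mA.
  rewrite big_ord0 /= diracE mem_set//= => -[].
  by case.
rewrite big_ord_recl -IH//= /cons_measure /pushforward.
have mB : measurable [set t : n.-tuple T | forall i, A (lift ord0 i) (tnth t i)].
  rewrite (_ : [set _ | _] = \bigcap_(i in [set: 'I_n])
     ((fun t : n.-tuple T => tnth t i) @^-1` A (lift ord0 i))).
    apply: fin_bigcap_measurable => // i _; rewrite -[X in measurable X]setTI.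
    exact: measurable_tnth.
  by apply/seteqP; split => t /= At i; [move=> _|]; exact: At.
rewrite -product_measure1E//; congr (_ _).
apply/seteqP; split => [[x t] /= At|[x t] /= [Ax At] i].
  split; first exact: (At ord0).
  by move=> i; have := At (lift ord0 i); rewrite tnthS.
by case: (unliftP ord0 i) => [j|] ->; rewrite ?tnthS.
Qed.

Section lebesgue.
Context (R : realType).

Definition lebesgue_Rn (n : nat) := tuple_measure (@lebesgue_measure R) n.

(* C is identified with R * R and C^n with
   (R * R)^n through [cpoint]. *)
Definition lebesgue_Cn (n : nat) :=
  tuple_measure
    (sf_product (@lebesgue_measure R) (@lebesgue_measure R)) n.

Definition cpoint (n : nat)
    (p : n.-tuple (measurableTypeR R * measurableTypeR R)) : 'rV[R[i]]_n :=
  \row_j Complex (tnth p j).1 (tnth p j).2.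

End lebesgue.

(* Frechet differentiability over C at every point of the open set D; stated
   over an abstract field because R[i] has no canonical topology of its own. *)
Definition holomorphic_on (C : numClosedFieldType) (n : nat) (D : set 'rV[C]_n)
    (f : 'rV[C]_n -> C) : Prop :=
  forall z, D z -> differentiable (f : 'rV[C]_n -> C^o) z.

Section rkhs.
Context (R : realType).

Definition dot_norm (H : lmodType R[i]) (dot : {dot H for Num.conj})
  (f : H) : R := Num.sqrt (complex.Re (dot f f)).

Definition dot_complete (H : lmodType R[i]) (dot : {dot H for Num.conj}) : Prop :=
  forall u : nat -> H,
    (forall e : R, 0 < e -> exists N, forall p q, (N <= p)%N -> (N <= q)%N ->
       dot_norm dot (u p - u q) < e) ->
    exists l : H, dot_norm dot (u k - l) @[k --> \oo] --> (0 : R).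

(* The Hilbert space of holomorphic functions on D with reproducing kernel K.
   It is presented as a Hilbert space [rkhs_sort] whose vectors are turned into
   functions by the linear map [rkhs_fun]; only the values on D matter, and by
   [rkhs_inj] a vector is determined by them. The inner product is linear in its
   first argument. *)
Record rkhs (n : nat) (D : set 'rV[R[i]]_n)
    (K : 'rV[R[i]]_n -> 'rV[R[i]]_n -> R[i]) := Rkhs {
  rkhs_sort :> lmodType R[i];
  rkhs_dot : {dot rkhs_sort for Num.conj};
  rkhs_complete : dot_complete rkhs_dot;
  rkhs_fun : rkhs_sort -> 'rV[R[i]]_n -> R[i];
  rkhs_linear : forall (a : R[i]) f g z,
    rkhs_fun (a *: f + g) z = a * rkhs_fun f z + rkhs_fun g z;
  rkhs_inj : forall f, (forall z, D z -> rkhs_fun f z = 0) -> f = 0;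
  rkhs_holomorphic : forall f, holomorphic_on D (rkhs_fun f);
  rkhs_reproducing : forall w, D w -> exists kw : rkhs_sort,
    (forall z, D z -> rkhs_fun kw z = K z w) /\
    (forall f, rkhs_fun f w = rkhs_dot f kw)
}.

Definition rkhs_norm (n : nat) (D : set 'rV[R[i]]_n) K (H : rkhs D K)
  (f : H) : R := dot_norm (rkhs_dot H) f.

End rkhs.

Section L2.
Context (R : realType) (n : nat) (D : set 'rV[R[i]]_n) (w : 'rV[R[i]]_n -> R).

Definition L2_int (f : 'rV[R[i]]_n -> R[i]) : \bar R :=
  (\int[lebesgue_Cn R n]_(p in cpoint (n := n) @^-1` D)
     (normc (f (cpoint p)) ^+ 2 * w (cpoint p))%:E)%E.

Definition L2_mem (f : 'rV[R[i]]_n -> R[i]) : Prop :=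
  [/\ measurable_fun (cpoint (n := n) @^-1` D) (fun p => complex.Re (f (cpoint p))),
      measurable_fun (cpoint (n := n) @^-1` D) (fun p => complex.Im (f (cpoint p))) &
      (L2_int f < +oo)%E].

Definition L2_norm (f : 'rV[R[i]]_n -> R[i]) : R :=
  Num.sqrt (fine (L2_int f)).

End L2.

Section hartogs.
Context (R : realType) (n : nat).

(* The dimension is n.+1 and coordinates are numbered from 0: for j < n,
   [cl z j] is z_j and [cr z j] is z_(j+1); [z 0 ord_max] is the last one. *)
Definition cl (z : 'rV[R[i]]_n.+1) (j : 'I_n) : R[i] :=
  z 0 (widen_ord (leqnSn n) j).
Definition cr (z : 'rV[R[i]]_n.+1) (j : 'I_n) : R[i] := z 0 (lift ord0 j).

Definition hartogs : set 'rV[R[i]]_n.+1 :=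
  [set z | (forall j : 'I_n, normc (cl z j) < normc (cr z j)) /\
           normc (z 0 ord_max) < 1].

Definition hartogs_kernel (m : 'I_n.+1 -> nat) (z w : 'rV[R[i]]_n.+1) : R[i] :=
  (\prod_(j < n) (cr z j * (cr w j)^*)^-1)
  * (\prod_(j < n)
       ((1 - (cl z j * (cl w j)^*) / (cr z j * (cr w j)^*))
          ^+ m (widen_ord (leqnSn n) j))^-1)
  * ((1 - z 0 ord_max * (w 0 ord_max)^*) ^+ m ord_max)^-1.

Definition hartogs_weight (m : 'I_n.+1 -> nat) (z : 'rV[R[i]]_n.+1) : R :=
  (pi ^+ n.+1)^-1
  * (\prod_(j < n)
       ((m (widen_ord (leqnSn n) j) - 1)%:R
        * (1 - normc (cl z j) ^+ 2 / normc (cr z j) ^+ 2)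
            ^+ (m (widen_ord (leqnSn n) j) - 2)))
  * ((m ord_max - 1)%:R * (1 - normc (z 0 ord_max) ^+ 2) ^+ (m ord_max - 2)).

Definition hartogs_space (m : 'I_n.+1 -> nat) := rkhs hartogs (hartogs_kernel m).

(* The j-th coordinate is (prod_(k >= j) t_k) e^(i theta_j). *)
Definition torus_point (t : 'I_n.+1 -> R)
    (theta : n.+1.-tuple (measurableTypeR R)) : 'rV[R[i]]_n.+1 :=
  \row_j Complex ((\prod_(k < n.+1 | (j <= k)%N) t k) * cos (tnth theta j))
                 ((\prod_(k < n.+1 | (j <= k)%N) t k) * sin (tnth theta j)).

(* With 0-based j, the exponent 2j-1 becomes 2j+1. *)
Definition torus_mean (f : 'rV[R[i]]_n.+1 -> R[i]) (t : 'I_n.+1 -> R) : \bar R :=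
  (\int[lebesgue_Rn R n.+1]_(theta in
       [set theta | forall j, (tnth theta j : R) \in `[0, 2 * pi]%R])
     (normc (f (torus_point t theta)) ^+ 2
      * (\prod_(j < n.+1) t j ^+ (j.*2.+1)) / (2 * pi) ^+ n.+1)%:E)%E.

End hartogs.

Arguments hartogs R n : clear implicits.
Arguments hartogs_space R n m : clear implicits.

(* Main.v *)
(* The functions e_a = sqrt(c_a) (prod_(j>=2) z_j)^-1 prod_j u_j^(a_j), with
   u_j = z_j / z_(j+1) and z_(n+1) = 1, come from the power series of the
   kernel: K(z, w) = sum_a e_a(z) conj(e_a(w)).  On the span of the kernel
   functions, which is dense, coefficients are explicit and the reproducing
   property turns the norm into the l^2 norm of the coefficients; hence every f
   is a sum of b_a e_a with ||f||^2 = sum_a |b_a|^2.  The torus action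
   z -> (e^(i theta_j) z_j) multiplies the e_a by pairwise distinct characters,
   so the mean of |f|^2 over the orbit of z is sum_a |b_a|^2 |e_a(z)|^2.  For
   m = (1, ..., 1) and the polyradii of (i) the weighted terms are
   |b_a|^2 prod_j t_j^(2 a_j + 1), and the supremum of their sum is the norm
   squared.  For (ii), volume and weight are invariant under the torus, so the
   integral of |f|^2 w is the sum of the |b_a|^2 times the integrals of
   |e_a|^2 w; integrating out z_1, z_2, ... in turn, where |z|^2 pushes the area
   of the plane forward to pi ds, reduces the latter to beta integrals, and they
   equal 1. *)
Require Import Defs.
From HB Require Import structures.
From mathcomp Require Import all_boot all_order all_algebra.
From mathcomp Require Import complex.
From mathcomp Require Import all_classical all_reals all_analysis.
From mathcomp Require Import measurable_realfun.
From mathcomp Require Import ring lra.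

Set Implicit Arguments.
Unset Strict Implicit.
Unset Printing Implicit Defensive.

Import Order.TTheory GRing.Theory Num.Theory.
Import numFieldNormedType.Exports.

Local Open Scope classical_set_scope.
Local Open Scope ring_scope.

Local Notation normc := Normc.normc.
Local Notation Re := complex.Re.
Local Notation Im := complex.Im.

(** * Complex numbers and coordinatewise limits *)

(** The [e_a] are never shown to be vectors of the space, and no orthonormal basis is built: an
    [rkhs] is known only through its evaluations. What replaces them is that passing from a
    combination of kernel vectors to its coefficients never increases the norm, measured in l^2; the
    coefficients of a general [f] are then limits along an approximating sequence. Partial sums run
    over boxes of multi-indices, because there the kernel series factors into one-variable series.
    Along a torus orbit, Cauchy-Schwarz bounds every partial sum squared by the constant ||f||^2
    K(z, z), so dominated convergence carries Parseval from finite sums to [f]. In (ii),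
    orthogonality in the weighted L^2 space is not proved either: averaging |f|^2 over the orbit
    first removes the cross terms pointwise and leaves an increasing limit of sums of nonnegative
    terms, to which monotone convergence applies. *)

Section complex_numbers.
Context {R : realType}.
Implicit Types z w : R[i].

Lemma complex_eqP z w : Re z = Re w -> Im z = Im w -> z = w.
Proof. by case: z w => [a b] [c d] /= -> ->. Qed.

Lemma cReD z w : Re (z + w) = Re z + Re w. Proof. by case: z w => ? ? []. Qed.
Lemma cImD z w : Im (z + w) = Im z + Im w. Proof. by case: z w => ? ? []. Qed.
Lemma cReN z : Re (- z) = - Re z. Proof. by case: z. Qed.
Lemma cImN z : Im (- z) = - Im z. Proof. by case: z. Qed.
Lemma cReM z w : Re (z * w) = Re z * Re w - Im z * Im w.
Proof. by case: z w => ? ? []. Qed.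
Lemma cImM z w : Im (z * w) = Re z * Im w + Im z * Re w.
Proof. by case: z w => ? ? []. Qed.
Lemma conjE z : z^* = Complex (Re z) (- Im z). Proof. by case: z. Qed.
Lemma cReJ z : Re z^* = Re z. Proof. by rewrite conjE. Qed.
Lemma cImJ z : Im z^* = - Im z. Proof. by rewrite conjE. Qed.

Lemma cRe_sum I (r : seq I) P (F : I -> R[i]) :
  Re (\sum_(i <- r | P i) F i) = \sum_(i <- r | P i) Re (F i).
Proof. by elim/big_rec2: _ => //= i y x _ <-; rewrite cReD. Qed.

Lemma normc_ge0 z : 0 <= normc z.
Proof. by case: z => a b; rewrite /= sqrtr_ge0. Qed.

Lemma normc2E z : normc z ^+ 2 = Re z ^+ 2 + Im z ^+ 2.
Proof. by case: z => a b; rewrite /= sqr_sqrtr// addr_ge0// sqr_ge0. Qed.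

Lemma mulcJ z : z * z^* = (normc z ^+ 2)%:C%C.
Proof. by rewrite conjE normc2E; apply: complex_eqP; rewrite ?cReM ?cImM/=; ring. Qed.

Lemma normc_conj z : normc z^* = normc z.
Proof. by rewrite conjE; case: z => a b /=; rewrite sqrrN. Qed.

Lemma normc_real (x : R) : normc x%:C%C = `|x|.
Proof. by rewrite /= expr0n addr0 sqrtr_sqr. Qed.

Lemma normcX z k : normc (z ^+ k) = normc z ^+ k.
Proof.
by elim: k => [|k IH]; rewrite ?expr0 ?Normc.normc1// !exprS Normc.normcM IH.
Qed.

Lemma normc_prod I (r : seq I) P (F : I -> R[i]) :
  normc (\prod_(i <- r | P i) F i) = \prod_(i <- r | P i) normc (F i).
Proof.
elim/big_rec2: _ => [|i y x _ <-]; first exact: Normc.normc1.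
by rewrite Normc.normcM.
Qed.

Lemma ler_normc_sum I (r : seq I) (F : I -> R[i]) :
  normc (\sum_(i <- r) F i) <= \sum_(i <- r) normc (F i).
Proof.
elim: r => [|a r IH]; first by rewrite !big_nil Normc.normc0.
by rewrite !big_cons (le_trans (le_normcD _ _))// lerD2l.
Qed.

Lemma normc_gt0 z : (0 < normc z) = (z != 0).
Proof.
rewrite lt_def normc_ge0 andbT; congr (~~ _); apply/eqP/eqP => [|->].
  exact: Normc.eq0_normc.
exact: Normc.normc0.
Qed.

Lemma ler_Re_normc z : `|Re z| <= normc z.
Proof.
rewrite -[leLHS]sqrtr_sqr; case: z => a b /=; rewrite ler_wsqrtr// lerDl.
exact: sqr_ge0.
Qed.

Lemma ler_Im_normc z : `|Im z| <= normc z.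
Proof.
rewrite -[leLHS]sqrtr_sqr; case: z => a b /=; rewrite ler_wsqrtr// lerDr.
exact: sqr_ge0.
Qed.

Lemma sqrr_normc_leP z (x : R) : 0 <= x -> normc z ^+ 2 <= x -> normc z <= Num.sqrt x.
Proof.
by move=> x0 zx; rewrite -(ger0_norm (normc_ge0 z)) -sqrtr_sqr ler_wsqrtr.
Qed.

End complex_numbers.

Section complex_limits.
Context {R : realType}.
Implicit Types u v : nat -> R[i].

(* [R[i]] carries no topology, so limits are taken coordinatewise. *)
Definition ccvg u (l : R[i]) :=
  (Re (u k) @[k --> \oo] --> Re l) /\ (Im (u k) @[k --> \oo] --> Im l).

Lemma ccvg_cst l : ccvg (fun=> l) l.
Proof. by split; exact: cvg_cst. Qed.

Lemma ccvgD u v l m : ccvg u l -> ccvg v m -> ccvg (fun k => u k + v k) (l + m).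
Proof.
move=> [ur ui] [vr vi]; split.
  by under eq_fun do rewrite cReD; rewrite cReD; exact: cvgD.
by under eq_fun do rewrite cImD; rewrite cImD; exact: cvgD.
Qed.

Lemma ccvgM u v l m : ccvg u l -> ccvg v m -> ccvg (fun k => u k * v k) (l * m).
Proof.
move=> [ur ui] [vr vi]; split.
  by under eq_fun do rewrite cReM; rewrite cReM; apply: cvgB; exact: cvgM.
by under eq_fun do rewrite cImM; rewrite cImM; apply: cvgD; exact: cvgM.
Qed.

Lemma ccvg_prod I (r : seq I) (u : I -> nat -> R[i]) (l : I -> R[i]) :
  (forall i, ccvg (u i) (l i)) ->
  ccvg (fun k => \prod_(i <- r) u i k) (\prod_(i <- r) l i).
Proof.
move=> ul; elim: r => [|i r IH].
  by under [X in ccvg X]eq_fun do rewrite big_nil; rewrite big_nil; exact: ccvg_cst.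
under [X in ccvg X]eq_fun do rewrite big_cons.
by rewrite big_cons; exact: ccvgM.
Qed.

Lemma ccvg_normc2 u l : ccvg u l ->
  normc (u k) ^+ 2 @[k --> \oo] --> normc l ^+ 2.
Proof.
move=> [ur ui]; rewrite normc2E; under eq_fun do rewrite normc2E.
by apply: cvgD; rewrite expr2; under eq_fun do rewrite expr2; exact: cvgM.
Qed.

Lemma ccvg_norm u l : ccvg u l <-> normc (u k - l) @[k --> \oo] --> (0 : R).
Proof.
split=> [ul|ul].
  have := ccvg_normc2 (ccvgD ul (ccvg_cst (- l))).
  rewrite subrr Normc.normc0 expr0n/= => /cvg_comp /(_ (@sqrt_continuous R 0)).
  rewrite sqrtr0; apply: cvg_trans; apply: near_eq_cvg; near=> k.
  by rewrite /= sqrtr_sqr ger0_norm// normc_ge0.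
split; apply/cvgrPdist_le => e e0; move/cvgrPdist_le/(_ e e0) : ul;
    apply: filterS => k; rewrite sub0r normrN (ger0_norm (normc_ge0 _)); apply: le_trans.
  by rewrite distrC -cReN -cReD ler_Re_normc.
by rewrite distrC -cImN -cImD ler_Im_normc.
Unshelve. all: by end_near. Qed.

(** The exchange of two limits in epsilon form: [e] is the error of replacing a vector by an
    approximant, uniform in [k], and [y] is the error for that approximant. *)
Lemma cvg0_approx (x : nat -> R) : (forall k, 0 <= x k) ->
  (forall e, 0 < e -> exists2 y : nat -> R, y k @[k --> \oo] --> (0 : R) &
     forall k, x k <= e + y k) -> x k @[k --> \oo] --> (0 : R).
Proof.
move=> x0 xy; apply/cvgrPdist_le => e e0.
have e20 : 0 < e / 2 by rewrite divr_gt0.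
have [y y0 xey] := xy _ e20.
move/cvgrPdist_le/(_ _ e20) : y0; apply: filterS => k.
rewrite !sub0r !normrN (ger0_norm (x0 k)) => yk.
by rewrite (le_trans (xey k))// [leRHS](splitr e) lerD2l (le_trans (ler_norm _)).
Qed.

Lemma ccvg_complete u : (forall e : R, 0 < e -> exists N, forall p q,
    (N <= p)%N -> (N <= q)%N -> normc (u p - u q) < e) -> exists l, ccvg u l.
Proof.
move=> uC.
have cau (f : R[i] -> R) : (forall z w, `|f z - f w| <= normc (z - w)) ->
    exists l : R, f (u k) @[k --> \oo] --> l.
  move=> flip; suff : cvgn (f \o u) by exists (limn (f \o u)).
  apply/cauchy_cvgP/cauchy_exP => e e0.
  have [N HN] := uC _ e0; exists (f (u N)), N => // k /= Nk.
  by apply: le_lt_trans (flip _ _) _; exact: HN.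
have [a ua] : exists l : R, Re (u k) @[k --> \oo] --> l.
  by apply: cau => z w; rewrite -cReN -cReD ler_Re_normc.
have [b ub] : exists l : R, Im (u k) @[k --> \oo] --> l.
  by apply: cau => z w; rewrite -cImN -cImD ler_Im_normc.
by exists (Complex a b).
Qed.

End complex_limits.

(** The discriminant inequality, read off at the minimiser [- b / a]. It is stated for plain real
    numbers so that it serves both finite sums and inner products. *)
Lemma nonneg_quadratic_sqr_le (R : realType) (a b c : R) :
  (forall s, 0 <= s ^+ 2 * a + 2 * s * b + c) -> 0 <= a -> b ^+ 2 <= a * c.
Proof.
move=> q a0; have [aE|an0] := eqVneq a 0; last first.
  have agt0 : 0 < a by rewrite lt_def an0.
  have := q (- b / a); rewrite -(pmulr_rge0 _ agt0).
  rewrite [X in 0 <= X](_ : _ = a * c - b ^+ 2) ?subr_ge0//.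
  by field.
subst a; have [->|bn0] := eqVneq b 0; first by rewrite mul0r expr0n.
(* With [a = 0] the polynomial is affine with nonzero slope, and it takes the value -1 at this
   point. *)
have := q (- (c + 1) / (2 * b)).
rewrite mulr0 add0r [X in 0 <= X](_ : _ = -1) ?ler0N1//.
by field.
Qed.

(* Triangle inequality for the square root of a nonnegative quadratic form, in
   terms of its values [a], [c] at two vectors and of its polarization [b]. *)
Lemma sqrt_quadratic_triangle (R : realType) (a b c : R) :
  (forall s, 0 <= s ^+ 2 * a + 2 * s * b + c) -> 0 <= a -> 0 <= c ->
  Num.sqrt (a + 2 * b + c) <= Num.sqrt a + Num.sqrt c.
Proof.
move=> q a0 c0; have bac := nonneg_quadratic_sqr_le q a0.
have sac : 0 <= Num.sqrt a + Num.sqrt c by rewrite addr_ge0// sqrtr_ge0.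
rewrite -[leRHS](ger0_norm sac) -sqrtr_sqr ler_wsqrtr// sqrrD !sqr_sqrtr//.
rewrite lerD2r lerD2l -[leRHS]mulr_natl ler_pM2l// -sqrtrM//.
by rewrite (le_trans (ler_norm _))// -sqrtr_sqr ler_wsqrtr.
Qed.

Section finite_sums.
Context {R : realType} (T : Type).
Implicit Types (r : seq T) (a b : T -> R[i]).

Definition sqsum r a : R := \sum_(i <- r) normc (a i) ^+ 2.

Lemma sqsum_ge0 r a : 0 <= sqsum r a.
Proof. by apply: sumr_ge0 => i _; exact: sqr_ge0. Qed.

Lemma sqsumDZ r a b (s : R) : sqsum r (fun i => s%:C%C * a i + b i) =
  s ^+ 2 * sqsum r a + 2 * s * (\sum_(i <- r) Re (a i * (b i)^*)) + sqsum r b.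
Proof.
rewrite /sqsum !mulr_sumr -!big_split/=; apply: eq_bigr => i _.
by rewrite !normc2E !(cReD, cImD, cReM, cImM, cReJ, cImJ)/=; ring.
Qed.

Lemma sqrt_sqsum_triangle r a b : Num.sqrt (sqsum r (fun i => a i + b i)) <=
  Num.sqrt (sqsum r a) + Num.sqrt (sqsum r b).
Proof.
have := sqsumDZ r a b 1; under eq_fun do rewrite mul1r.
rewrite expr1n mul1r mulr1 => ->; apply: sqrt_quadratic_triangle; rewrite ?sqsum_ge0// => s.
by rewrite -sqsumDZ sqsum_ge0.
Qed.

(** Cauchy-Schwarz without conjugation: after the triangle inequality only the moduli matter, and
    the quadratic is the sum of the squares of [s * normc (a i) + normc (b i)]. *)
Lemma normc_sum_le r a b : normc (\sum_(i <- r) a i * b i) <=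
  Num.sqrt (sqsum r a) * Num.sqrt (sqsum r b).
Proof.
apply: le_trans (ler_normc_sum _ _) _; rewrite -sqrtrM ?sqsum_ge0//.
under eq_bigr do rewrite Normc.normcM.
rewrite (le_trans (ler_norm _))// -sqrtr_sqr ler_wsqrtr//.
apply: nonneg_quadratic_sqr_le; last exact: sqsum_ge0.
move=> s; rewrite /sqsum !mulr_sumr -!big_split/=; apply: sumr_ge0 => i _.
by rewrite (_ : _ + _ = (s * normc (a i) + normc (b i)) ^+ 2) ?sqr_ge0//; ring.
Qed.

End finite_sums.

(** * Norm inequalities in a complex inner product space *)

Section hilbert.
Context {R : realType} (H : lmodType R[i]) (dot : {dot H for Num.conj}).
Implicit Types u v w : H.

Definition sqn u : R := Re (dot u u).

Lemma dot_sqn u : dot u u = (sqn u)%:C%C.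
Proof.
have := dnorm_ge0 dot u; rewrite lecE => /andP[/eqP i0 _].
by apply: complex_eqP => //=; rewrite i0.
Qed.

Lemma sqn_ge0 u : 0 <= sqn u.
Proof. by have := dnorm_ge0 dot u; rewrite dot_sqn ler0c. Qed.

Lemma dotC u v : dot u v = (dot v u)^*.
Proof. by rewrite hermC/= expr0 mul1r. Qed.

Lemma dot_norm_sqn u : dot_norm dot u ^+ 2 = sqn u.
Proof. by rewrite sqr_sqrtr// sqn_ge0. Qed.

Lemma sqnDZ u v (c : R[i]) :
  sqn (c *: u + v) = normc c ^+ 2 * sqn u + 2 * Re (c * dot u v) + sqn v.
Proof.
have Zl x y : dot (c *: x) y = c * dot x y by rewrite linearZl_LR.
have Zr x y : dot x (c *: y) = c^* * dot x y by rewrite linearZr_LR.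
rewrite /sqn linearDl/= !linearDr/= !Zr !Zl (dotC v u) mulrCA mulrA mulcJ.
by rewrite dot_sqn !(cReD, cReM, cImM, cReJ, cImJ)/=; ring.
Qed.

Lemma sqnN u : sqn (- u) = sqn u.
Proof. by rewrite /sqn hnormN. Qed.

Lemma sqnDZr u v (s : R) :
  sqn (s%:C%C *: u + v) = s ^+ 2 * sqn u + 2 * s * Re (dot u v) + sqn v.
Proof. by rewrite sqnDZ normc_real real_normK ?num_real// cReM/=; ring. Qed.

Lemma dot_norm_triangle u v : dot_norm dot (u + v) <= dot_norm dot u + dot_norm dot v.
Proof.
have := sqnDZr u v 1; rewrite scale1r expr1n mul1r mulr1.
rewrite /dot_norm -!/(sqn _) => ->.
apply: sqrt_quadratic_triangle; rewrite ?sqn_ge0// => s.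
by rewrite -sqnDZr sqn_ge0.
Qed.

Lemma dot_normN u : dot_norm dot (- u) = dot_norm dot u.
Proof. by rewrite /dot_norm hnormN. Qed.

Lemma dot_norm_ge0 u : 0 <= dot_norm dot u. Proof. exact: sqrtr_ge0. Qed.

(** Multiplying [u] by the conjugate of [c = dot u v] makes the cross term real, equal to [s] times
    |c|^2. The discriminant inequality then holds with an extra factor |c|^2 on both sides, and the
    case [c = 0] is set apart so that this factor can be cancelled. *)
Lemma dot_cauchy_schwarz u v :
  normc (dot u v) <= dot_norm dot u * dot_norm dot v.
Proof.
have [->|d0] := eqVneq (dot u v) 0.
  by rewrite Normc.normc0 mulr_ge0// dot_norm_ge0.
rewrite -normc_gt0 in d0; set c := dot u v in d0 *.
have : normc c ^+ 2 <= sqn u * sqn v.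
  rewrite -(ler_pM2l (exprn_gt0 2 d0)).
  have -> : normc c ^+ 2 * (sqn u * sqn v) = (normc c ^+ 2 * sqn u) * sqn v by ring.
  rewrite -expr2; apply: nonneg_quadratic_sqr_le; last first.
    by rewrite mulr_ge0 ?sqn_ge0// sqr_ge0.
  move=> s; have := sqn_ge0 ((s%:C%C * c^*) *: u + v).
  rewrite sqnDZ Normc.normcM normc_real normc_conj exprMn real_normK ?num_real//.
  by rewrite -mulrA [c^* * _]mulrC mulcJ -rmorphM/= !mulrA.
move=> /(sqrr_normc_leP (mulr_ge0 (sqn_ge0 _) (sqn_ge0 _))).
by rewrite sqrtrM ?sqn_ge0.
Qed.

Lemma parallelogram u v : sqn (u + v) + sqn (u - v) = 2 * sqn u + 2 * sqn v.
Proof.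
have := sqnDZr u v 1; have := sqnDZr u (- v) 1.
rewrite scale1r sqnN linearNr/= cReN => -> ->; ring.
Qed.

End hilbert.

(** * Expansions in a reproducing kernel Hilbert space *)

Lemma ler_sum_subset (R : realType) (T : eqType) (r s : seq T) (F : T -> R) :
  uniq r -> uniq s -> {subset r <= s} -> (forall i, 0 <= F i) ->
  \sum_(i <- r) F i <= \sum_(i <- s) F i.
Proof.
move=> ur us rs F0.
have rsE : perm_eq r [seq x <- s | x \in r].
  apply: uniq_perm => //; first exact: filter_uniq.
  by move=> x; rewrite mem_filter andb_idr//; exact: rs.
rewrite (perm_big _ rsE)/=.
rewrite big_filter big_mkcond/=; apply: ler_sum => i _.
by case: ifP.
Qed.

Lemma cvg_invS (R : realType) : (k.+1%:R^-1 : R) @[k --> \oo] --> (0 : R).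
Proof. exact: cvg_harmonic. Qed.

Lemma nondecreasing_seq_le_limit (R : realType) (u : nat -> R) (l : R) :
  nondecreasing_seq u -> u k @[k --> \oo] --> l -> forall N, u N <= l.
Proof.
move=> nd ul N; rewrite -(cvg_lim _ ul)//.
by apply: nondecreasing_cvgn_le => //; apply/cvg_ex; exists l.
Qed.

Lemma cvg_sum_seq (R : realType) (I : eqType) (r : seq I) (u : I -> nat -> R)
    (l : I -> R) : (forall i, i \in r -> u i k @[k --> \oo] --> l i) ->
  \sum_(i <- r) u i k @[k --> \oo] --> \sum_(i <- r) l i.
Proof.
elim: r => [|i r IH] ul.
  by under eq_fun do rewrite big_nil; rewrite big_nil; exact: cvg_cst.
under eq_fun do rewrite big_cons; rewrite big_cons.
apply: cvgD; first by apply: ul; rewrite mem_head.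
by apply: IH => j jr; apply: ul; rewrite inE jr orbT.
Qed.

Section rkhs_kernel_span.
Context {R : realType} (n : nat) (D : set 'rV[R[i]]_n).
Context (K : 'rV[R[i]]_n -> 'rV[R[i]]_n -> R[i]) (H : rkhs D K).
Implicit Types f g h : H.

Local Notation dot := (rkhs_dot H).

Lemma rkhs_funD f g z : rkhs_fun (f + g) z = rkhs_fun f z + rkhs_fun g z.
Proof. by rewrite -[f]scale1r rkhs_linear mul1r scale1r. Qed.

Lemma rkhs_fun0 z : rkhs_fun (0 : H) z = 0.
Proof.
by apply: (addrI (rkhs_fun (0 : H) z)); rewrite -rkhs_funD !addr0.
Qed.

Lemma rkhs_funZ c f z : rkhs_fun (c *: f) z = c * rkhs_fun f z.
Proof. by rewrite -[c *: f]addr0 rkhs_linear rkhs_fun0 addr0. Qed.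

Lemma rkhs_funN f z : rkhs_fun (- f) z = - rkhs_fun f z.
Proof. by rewrite -scaleN1r rkhs_funZ mulN1r. Qed.

Lemma rkhs_funB f g z : rkhs_fun (f - g) z = rkhs_fun f z - rkhs_fun g z.
Proof. by rewrite rkhs_funD rkhs_funN. Qed.

Variable kv : 'rV[R[i]]_n -> H.
Hypothesis kvE : forall w, D w -> (forall z, D z -> rkhs_fun (kv w) z = K z w) /\
  (forall f, rkhs_fun f w = dot f (kv w)).

Definition kspan (l : seq (R[i] * 'rV[R[i]]_n)) : H :=
  \sum_(p <- l) p.1 *: kv p.2.

Definition in_domain (l : seq (R[i] * 'rV[R[i]]_n)) :=
  forall p, p \in l -> D p.2.

Lemma kspan_cons c w l : kspan ((c, w) :: l) = c *: kv w + kspan l.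
Proof. by rewrite /kspan big_cons. Qed.

(* A near-best approximation is compared with its perturbation along [kv w],
   with coefficient a multiple of the error at [w]. *)
Lemma near_best_approx_evaluation f l d e w : in_domain l ->
  (forall l', in_domain l' -> d <= sqn dot (f - kspan l')) ->
  sqn dot (f - kspan l) <= d + e -> D w ->
  normc (rkhs_fun (f - kspan l) w) ^+ 2 <= (sqn dot (kv w) + 1) * e.
Proof.
move=> vl dl le Dw; set x := rkhs_fun _ w; set k := sqn dot (kv w).
have k0 : 0 <= k by exact: sqn_ge0.
have k10 : 0 < k + 1 by rewrite ltr_wpDl.
(* The exact minimiser would have coefficient [x / k]; [k + 1] avoids dividing by zero when
   [kv w = 0], and the squared distance still drops by at least [normc x ^+ 2 / (k + 1)]. *)
have vl' : in_domain (((k + 1)^-1%:C%C * x, w) :: l).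
  by move=> p; rewrite inE => /orP[/eqP ->//|]; exact: vl.
have := dl _ vl'.
rewrite kspan_cons opprD addrCA -scaleNr sqnDZ dotC -(kvE Dw).2 -/x -/k.
rewrite normcN Normc.normcM normc_real ger0_norm ?invr_ge0 ?(ltW k10)//.
rewrite mulNr -[_ * x * _]mulrA mulcJ cReN cReM/= mul0r subr0 => dle.
have : (k + 1)^-1 * normc x ^+ 2 <= e.
  have y0 : 0 <= (k + 1)^-2 * normc x ^+ 2.
    by rewrite mulr_ge0 ?sqr_ge0// invr_ge0 sqr_ge0.
  have E : ((k + 1)^-1 * normc x) ^+ 2 * k =
      (k + 1)^-1 * normc x ^+ 2 - (k + 1)^-2 * normc x ^+ 2.
    by field; rewrite gt_eqF.
  rewrite E in dle.
  lra.
by rewrite -ler_pdivrMl.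
Qed.

(** A sequence minimising the distance from [f] to the span is Cauchy by the parallelogram law,
    hence has a limit [h]. Near-best approximation makes the error small at every point of [D], so
    [f] and [h] have the same values there and coincide by [rkhs_inj]. *)
Lemma kspan_dense f : exists2 l : nat -> seq (R[i] * 'rV[R[i]]_n),
  (forall k, in_domain (l k)) &
  dot_norm dot (f - kspan (l k)) @[k --> \oo] --> (0 : R).
Proof.
pose S := [set x | exists2 l, in_domain l & x = sqn dot (f - kspan l)].
have Slb : lbound S 0 by move=> _ [l _ ->]; exact: sqn_ge0.
have S0 : S !=set0 by exists (sqn dot (f - kspan [::])), [::].
have infS : has_inf S by split => //; exists 0.
pose d := inf S.
have dl l : in_domain l -> d <= sqn dot (f - kspan l).
  by move=> vl; apply: ge_inf; [exists 0|exists l].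
have /choice[l ll] : forall k, exists l, in_domain l /\
    sqn dot (f - kspan l) <= d + k.+1%:R^-1.
  move=> k; have [|_ [l vl ->] /ltW lt] := @inf_adherent _ S k.+1%:R^-1 _ infS.
    by rewrite invr_gt0.
  by exists l.
exists l; first by move=> k; exact: (ll k).1.
have cauchy : forall e : R, 0 < e -> exists N, forall p q, (N <= p)%N -> (N <= q)%N ->
    dot_norm dot (kspan (l p) - kspan (l q)) < e.
  (* The parallelogram law will bound the squared distance by [2 / (p + 1) + 2 / (q + 1)], which is
     then below four fifths of [e ^+ 2]. *)
  move=> e e0; have e24 : 0 < e ^+ 2 / 5 by rewrite divr_gt0// exprn_gt0.
  have /cvgrPdist_lt/(_ _ e24)[N _ HN] := @cvg_invS R.
  exists N => p q Np Nq.
  rewrite -(ltr_pXn2r (n := 2)) ?nnegrE ?dot_norm_ge0 ?(ltW e0)//.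
  rewrite dot_norm_sqn.
  have := parallelogram dot (f - kspan (l p)) (f - kspan (l q)).
  (* [kspan l2] is the midpoint of the two approximants; being in the span, it is at squared
     distance at least [d] from [f]. *)
  pose l2 := [seq (2^-1%:C%C * x.1, x.2) | x <- l p ++ l q].
  have -> : f - kspan (l p) + (f - kspan (l q)) = (2%:C%C : R[i]) *: (f - kspan l2) + 0.
    rewrite addr0 /l2 /kspan big_map scalerBr scaler_sumr.
    under [X in _ = _ - X]eq_bigr do rewrite /= scalerA mulrA -rmorphM/= mulfV// mul1r.
    rewrite big_cat/= opprD addrACA; congr (_ + _).
    by rewrite -[f]scale1r -scalerDl scalerA -rmorphD/= mulr1.
  have -> : f - kspan (l p) - (f - kspan (l q)) = - (kspan (l p) - kspan (l q)).
    by rewrite opprD opprK addrACA subrr add0r opprB addrC.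
  have sqn0 : sqn dot 0 = 0 by rewrite /sqn linear0r.
  rewrite sqnN sqnDZr linear0r/= mulr0 sqn0 !addr0.
  have := dl l2; have /[swap]/[apply] : in_domain l2.
    move=> x /mapP[y]; rewrite mem_cat => /orP[] yl ->/=.
      exact: (ll p).1 _ yl.
    exact: (ll q).1 _ yl.
  have := HN _ Np; have := HN _ Nq; rewrite /= !sub0r !normrN.
  rewrite !gtr0_norm ?invr_gt0//.
  have := (ll p).2; have := (ll q).2.
  move: (sqn dot (kspan (l p) - kspan (l q))) (sqn dot (f - kspan l2)) => X Y.
  move: (sqn dot (f - kspan (l p))) (sqn dot (f - kspan (l q))) => Xp Xq.
  move: (p.+1%:R^-1) (q.+1%:R^-1) => P Q.
  move: e24; move: (e ^+ 2) => E2.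
  lra.
have [h hl] := rkhs_complete cauchy.
suff <- : h = f.
  apply: cvg_trans hl; apply: near_eq_cvg; apply: nearW => k /=.
  by rewrite -[in LHS]opprB dot_normN.
apply/esym/eqP; rewrite -subr_eq0; apply/eqP/rkhs_inj => w Dw.
apply: Normc.eq0_normc; apply/eqP; rewrite eq_le normc_ge0 andbT.
pose c := sqn dot (kv w) + 1.
have c0 : 0 <= c by rewrite addr_ge0// sqn_ge0.
(* This bounds the value of [f - h] at [w]: the first term comes from the near-best approximation,
   the second from Cauchy-Schwarz against [kv w]. *)
have cvg1 : Num.sqrt (c * k.+1%:R^-1) +
    dot_norm dot (kspan (l k) - h) * dot_norm dot (kv w) @[k --> \oo] --> (0 : R).
  rewrite -[X in _ --> X]addr0 -[X in _ --> _ + X](mul0r (dot_norm dot (kv w))).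
  apply: cvgD; last by apply: cvgMl.
  have : c * k.+1%:R^-1 @[k --> \oo] --> (0 : R).
    by rewrite -[X in _ --> X](mulr0 c); apply: cvgMr; exact: cvg_invS.
  by move=> /cvg_comp/(_ (@sqrt_continuous R 0)); rewrite sqrtr0.
apply: (ler_cvg_to (cvg_cst _) cvg1); apply: nearW => k /=.
have -> : f - h = (f - kspan (l k)) + (kspan (l k) - h) by rewrite addrA subrK.
rewrite rkhs_funD (le_trans (le_normcD _ _))// lerD//.
  apply: sqrr_normc_leP; first by rewrite mulr_ge0.
  exact: (near_best_approx_evaluation (ll k).1 dl (ll k).2 Dw).
by rewrite (kvE Dw).2 dot_cauchy_schwarz.
Qed.

(** * Expansion of a vector along a series for the kernel *)

Section expansion.
Variables (T : eqType) (B : nat -> seq T) (e : T -> 'rV[R[i]]_n -> R[i]).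
Hypotheses (Buniq : forall N, uniq (B N))
  (Bsub : forall N M, (N <= M)%N -> {subset B N <= B M}).
Hypothesis KE : forall z w, D z -> D w ->
  ccvg (fun N => \sum_(a <- B N) e a z * (e a w)^*) (K z w).

Lemma sqsum_nondecreasing (c : T -> R[i]) :
  nondecreasing_seq (fun N => sqsum (B N) c).
Proof.
by move=> N M NM; apply: ler_sum_subset => //; [exact: Bsub|move=> i; exact: sqr_ge0].
Qed.

(** The conjugate appears because the kernel function at [w] is the sum of the [e a] with
    coefficients [(e a w)^*]. The coefficients belong to the list and not to the vector [kspan l]:
    no independence of the [e a] is assumed, and [kcoefB_sqsum_le] is what makes them depend on the
    vector alone. *)
Definition kcoef (l : seq (R[i] * 'rV[R[i]]_n)) a : R[i] :=
  \sum_(p <- l) p.1 * (e a p.2)^*.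

Lemma kcoef_cons c w l a : kcoef ((c, w) :: l) a = c * (e a w)^* + kcoef l a.
Proof. by rewrite /kcoef big_cons. Qed.

Lemma kspan_expansion l z : in_domain l -> D z ->
  ccvg (fun N => \sum_(a <- B N) kcoef l a * e a z) (rkhs_fun (kspan l) z).
Proof.
move=> + Dz; elim: l => [|[c w] l IH] vl.
  rewrite /kspan big_nil rkhs_fun0.
  under [X in ccvg X]eq_fun do under eq_bigr do rewrite /kcoef big_nil mul0r.
  by under [X in ccvg X]eq_fun do rewrite big1//; exact: ccvg_cst.
have Dw : D w by exact: vl (c, w) (mem_head _ _).
rewrite kspan_cons rkhs_linear (kvE Dw).1//.
under [X in ccvg X]eq_fun.
  move=> N; under eq_bigr do rewrite kcoef_cons mulrDl mulrAC -mulrA.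
  rewrite big_split/= -mulr_sumr; over.
apply: ccvgD; first exact: ccvgM (ccvg_cst _) (KE Dz Dw).
by apply: IH => p pl; apply: vl; rewrite inE pl orbT.
Qed.

(** Pairing with [kv w] is evaluation at [w], so induction on [l'] reduces this to the pointwise
    expansion of [kspan l]. *)
Lemma kspan_dot_expansion l l' : in_domain l -> in_domain l' ->
  ccvg (fun N => \sum_(a <- B N) kcoef l a * (kcoef l' a)^*)
       (dot (kspan l) (kspan l')).
Proof.
move=> vl; elim: l' => [|[c w] l' IH] vl'.
  rewrite [kspan [::]]/kspan big_nil linear0r.
  under [X in ccvg X]eq_fun do under eq_bigr do rewrite /kcoef big_nil rmorph0 mulr0.
  by under [X in ccvg X]eq_fun do rewrite big1//; exact: ccvg_cst.
have Dw : D w by exact: vl' (c, w) (mem_head _ _).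
rewrite kspan_cons linearDr/= linearZr_LR/= -(kvE Dw).2.
under [X in ccvg X]eq_fun.
  move=> N; under eq_bigr do rewrite kcoef_cons rmorphD rmorphM/= conjCK mulrDr mulrCA.
  rewrite big_split/= -mulr_sumr; over.
apply: ccvgD; first exact: ccvgM (ccvg_cst _) (kspan_expansion vl Dw).
by apply: IH => p pl; apply: vl'; rewrite inE pl orbT.
Qed.

Lemma kcoef_sqsum_cvg l : in_domain l ->
  sqsum (B N) (kcoef l) @[N --> \oo] --> sqn dot (kspan l).
Proof.
move=> vl; have [+ _] := kspan_dot_expansion vl vl; apply: cvg_trans.
apply: near_eq_cvg; apply: nearW => N; rewrite cRe_sum; apply: eq_bigr => a _.
by rewrite mulcJ.
Qed.

(** A Bessel inequality. A difference of two combinations is again one, for the concatenated list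
    with negated coefficients, and the partial sums increase to its squared norm. *)
Lemma kcoefB_sqsum_le l l' N : in_domain l -> in_domain l' ->
  Num.sqrt (sqsum (B N) (fun a => kcoef l a - kcoef l' a)) <=
  dot_norm dot (kspan l - kspan l').
Proof.
move=> vl vl'; pose m := l ++ [seq (- p.1, p.2) | p <- l'].
have vm : in_domain m.
  by move=> p; rewrite mem_cat => /orP[/vl//|/mapP[q /vl' Dq ->]].
have -> : kspan l - kspan l' = kspan m.
  rewrite /kspan big_cat/= big_map -sumrN; congr (_ + _).
  by apply: eq_bigr => p _; rewrite scaleNr.
have -> : (fun a => kcoef l a - kcoef l' a) = kcoef m.
  apply/funext => a; rewrite /kcoef big_cat/= big_map -sumrN; congr (_ + _).
  by apply: eq_bigr => p _; rewrite mulNr.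
apply: ler_wsqrtr; rewrite -/(sqn _ _).
exact: nondecreasing_seq_le_limit (sqsum_nondecreasing _) (kcoef_sqsum_cvg vm) N.
Qed.

Lemma kernel_sqsum_le z N : D z ->
  sqsum (B N) (e ^~ z) <= Re (K z z).
Proof.
move=> Dz.
have cvgK : sqsum (B N) (e ^~ z) @[N --> \oo] --> Re (K z z).
  have [+ _] := KE Dz Dz; apply: cvg_trans; apply: near_eq_cvg; apply: nearW => M.
  by rewrite cRe_sum; apply: eq_bigr => a _; rewrite mulcJ.
exact: nondecreasing_seq_le_limit (sqsum_nondecreasing _) cvgK N.
Qed.

(** By the Bessel inequality the coefficients of an approximating sequence [l k] are Cauchy for each
    index; their limits [c] serve [f]. Both claims compare [f] with one fixed approximant, with an
    error bounded uniformly in [N]. *)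
Lemma rkhs_expansion_aux f : exists c : T -> R[i],
  (forall z, D z -> ccvg (fun N => \sum_(a <- B N) c a * e a z) (rkhs_fun f z)) /\
  sqsum (B N) c @[N --> \oo] --> dot_norm dot f ^+ 2.
Proof.
have [l vl lf] := kspan_dense f.
pose d k := dot_norm dot (f - kspan (l k)).
have dd p q : dot_norm dot (kspan (l p) - kspan (l q)) <= d p + d q.
  have -> : kspan (l p) - kspan (l q) = - (f - kspan (l p)) + (f - kspan (l q)).
    by rewrite opprB addrA subrK.
  by rewrite (le_trans (dot_norm_triangle _ _ _))// dot_normN.
(* An index outside every [B N] is never summed over and gets the value 0. *)
have /choice[c cl] : forall a, exists c, (exists N, a \in B N) ->
    ccvg (fun k => kcoef (l k) a) c.
  move=> a; have [[N aN]|] := pselect (exists N, a \in B N); last by exists 0.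
  suff [c Hc] : exists c, ccvg (fun k => kcoef (l k) a) c by exists c.
  apply: ccvg_complete => x x0; have x20 : 0 < x / 2 by rewrite divr_gt0.
  have /cvgrPdist_lt/(_ _ x20)[M _ HM] := lf; exists M => p q Mp Mq.
  apply: (@le_lt_trans _ _ (dot_norm dot (kspan (l p) - kspan (l q)))).
    apply: le_trans (kcoefB_sqsum_le N (vl p) (vl q)).
    apply: sqrr_normc_leP; first exact: sqsum_ge0.
    rewrite /sqsum (bigD1_seq a)//= lerDl; apply: sumr_ge0 => i _.
    exact: sqr_ge0.
  apply: le_lt_trans (dd p q) _; rewrite [ltRHS](splitr x).
  have := HM _ Mp; have := HM _ Mq; rewrite /= !sub0r !normrN.
  by rewrite !ger0_norm ?dot_norm_ge0// => ? ?; rewrite ltrD.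
(* Letting [p] go to infinity in the Bessel inequality for [l p] and [l k]: for fixed [N] the sum is
   finite, and the bound obtained is independent of [N]. *)
have cle N k : Num.sqrt (sqsum (B N) (fun a => c a - kcoef (l k) a)) <= d k.
  have cv1 : Num.sqrt (sqsum (B N) (fun a => kcoef (l p) a - kcoef (l k) a))
      @[p --> \oo] --> Num.sqrt (sqsum (B N) (fun a => c a - kcoef (l k) a)).
    apply: (@cvg_comp _ _ _ _ Num.sqrt _ _ _ _ (@sqrt_continuous R _)).
    apply: cvg_sum_seq => a aN; apply: ccvg_normc2; apply: ccvgD (ccvg_cst _).
    by apply: cl; exists N.
  have cv2 : d p + d k @[p --> \oo] --> 0 + d k by apply: cvgD lf (cvg_cst _).
  rewrite add0r in cv2.
  apply: (ler_cvg_to cv1 cv2); apply: nearW => p.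
  exact: le_trans (kcoefB_sqsum_le N (vl p) (vl k)) (dd p k).
exists c; split=> [z Dz|].
  apply/ccvg_norm/cvg0_approx => [k|x x0]; first exact: normc_ge0.
  (* The coefficient error costs [d k] times the first summand, the value of [f - kspan (l k)] at
     [z] costs [d k] times the second; the 1 makes [kz] positive. *)
  pose kz := Num.sqrt (Re (K z z)) + dot_norm dot (kv z) + 1.
  have kz0 : 0 < kz by rewrite ltr_wpDl// addr_ge0// ?sqrtr_ge0 ?dot_norm_ge0.
  have xk0 : 0 < x / kz by rewrite divr_gt0.
  have /cvgrPdist_le/(_ _ xk0)[k _ /(_ k (leqnn k))] := lf.
  rewrite /= sub0r normrN ger0_norm ?dot_norm_ge0// -/(d k) => dk.
  exists (fun N => normc (\sum_(a <- B N) kcoef (l k) a * e a z - rkhs_fun (kspan (l k)) z)).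
    by apply/ccvg_norm; exact: kspan_expansion.
  move=> N.
  rewrite [X in normc X <= _](_ : _ = \sum_(a <- B N) (c a - kcoef (l k) a) * e a z +
    (- rkhs_fun (f - kspan (l k)) z) +
    (\sum_(a <- B N) kcoef (l k) a * e a z - rkhs_fun (kspan (l k)) z)); last first.
    rewrite rkhs_funB; under [in RHS]eq_bigr do rewrite mulrBl.
    by rewrite sumrB; ring.
  rewrite (le_trans (le_normcD _ _))// lerD2r (le_trans (le_normcD _ _))//.
  rewrite normcN (kvE Dz).2.
  have := normc_sum_le (B N) (fun a => c a - kcoef (l k) a) (e ^~ z).
  have := dot_cauchy_schwarz dot (f - kspan (l k)) (kv z).
  have := ler_wsqrtr (kernel_sqsum_le N Dz); have := cle N k.
  have d0 : 0 <= d k by exact: dot_norm_ge0.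
  rewrite -/(d k) => h1 h2 h3 h4.
  apply: le_trans (lerD h4 h3) _.
  have h5 := ler_pM (sqrtr_ge0 _) (sqrtr_ge0 _) h1 h2.
  apply: le_trans (lerD h5 (lexx _)) _; rewrite -mulrDr.
  rewrite ler_pdivlMr// in dk; apply: le_trans dk.
  by rewrite ler_wpM2l// lerDl.
(* Triangle inequalities, in l^2 and in the space, each lose [d k]; hence the choice of [k] with
   [d k] at most [x / 2]. *)
have cvs : `|Num.sqrt (sqsum (B N) c) - dot_norm dot f| @[N --> \oo] --> (0 : R).
  apply: cvg0_approx => // x x0; have x20 : 0 < x / 2 by rewrite divr_gt0.
  have /cvgrPdist_le/(_ _ x20)[k _ /(_ k (leqnn k))] := lf.
  rewrite /= sub0r normrN ger0_norm ?dot_norm_ge0// -/(d k) => dk.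
  exists (fun N => `|Num.sqrt (sqsum (B N) (kcoef (l k))) - dot_norm dot (kspan (l k))|).
    apply/norm_cvg0P/subr_cvg0.
    have /cvg_comp/(_ (@sqrt_continuous R _)) := kcoef_sqsum_cvg (vl k).
    exact.
  move=> N.
  have t1 := dot_norm_triangle dot (f - kspan (l k)) (kspan (l k)).
  have t2 := dot_norm_triangle dot (- (f - kspan (l k))) f.
  have t3 := sqrt_sqsum_triangle (B N) (fun a => c a - kcoef (l k) a) (kcoef (l k)).
  have t4 := sqrt_sqsum_triangle (B N) (fun a => - (c a - kcoef (l k) a)) c.
  rewrite dot_normN opprB subrK in t2; rewrite subrK in t1.
  rewrite (_ : (fun a => _ + _) = c) in t3; last by apply/funext => a; rewrite subrK.
  rewrite (_ : (fun a => _ + _) = kcoef (l k)) in t4; last first.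
    by apply/funext => a; rewrite opprB subrK.
  have E : sqsum (B N) (fun a => - (c a - kcoef (l k) a)) =
           sqsum (B N) (fun a => c a - kcoef (l k) a).
    by apply: eq_bigr => a _; rewrite normcN.
  rewrite E in t4; have := cle N k; move: t1 t2 t3 t4 dk; rewrite -/(d k).
  set F := dot_norm dot f; set G := dot_norm dot (kspan _).
  set p := Num.sqrt (sqsum _ c); set q := Num.sqrt (sqsum _ (kcoef _)).
  move: (Num.sqrt _) (d k) => y dk.
  have := ler_norm (q - G); have := ler_norm (- (q - G)); rewrite normrN.
  move: (`|q - G|) => z z1 z2 t1 t2 t3 t4 t5 t6.
  by rewrite ler_norml; apply/andP; split; lra.
have : Num.sqrt (sqsum (B N) c) @[N --> \oo] --> dot_norm dot f.
  by move/norm_cvg0P/subr_cvg0 : cvs.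
move=> h; rewrite expr2; apply: cvg_trans (cvgM h h).
apply: near_eq_cvg; apply: nearW => N /=.
by rewrite -expr2 sqr_sqrtr// sqsum_ge0.
Qed.

End expansion.

End rkhs_kernel_span.

Lemma rkhs_expansion (R : realType) (n : nat) (D : set 'rV[R[i]]_n) K
    (H : rkhs D K) (T : eqType) (B : nat -> seq T)
    (e : T -> 'rV[R[i]]_n -> R[i]) :
  (forall N, uniq (B N)) ->
  (forall N M, (N <= M)%N -> {subset B N <= B M}) ->
  (forall z w, D z -> D w ->
    ccvg (fun N => \sum_(a <- B N) e a z * (e a w)^*) (K z w)) ->
  forall f : H, exists c : T -> R[i],
  (forall z, D z -> ccvg (fun N => \sum_(a <- B N) c a * e a z) (rkhs_fun f z)) /\
  sqsum (B N) c @[N --> \oo] --> rkhs_norm f ^+ 2.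
Proof.
move=> Bu Bs KE f.
have /choice[kv kvE] : forall w, exists k : H, D w ->
    (forall z, D z -> rkhs_fun k z = K z w) /\
    (forall f, rkhs_fun f w = rkhs_dot H f k).
  move=> w; have [Dw|nDw] := pselect (D w); last by exists 0.
  by have [k ?] := rkhs_reproducing H Dw; exists k.
exact: rkhs_expansion_aux kvE _ _ _ Bu Bs KE f.
Qed.

(** * Power series of the Hartogs kernel *)

Section negative_binomial_series.

(** Pascal's rule, telescoped: multiplying by [1 - x] lowers the order of the series by one, up to a
    boundary term. Working in any ring lets the identity serve both the real bound and the complex
    limit. *)
Lemma negative_binomial_recurrence (A : comNzRingType) (x : A) m N :
  (1 - x) * (\sum_(k < N) 'C(m.+1 + k, m.+1)%:R * x ^+ k) +
    'C(m + N, m.+1)%:R * x ^+ N = \sum_(k < N) 'C(m + k, m)%:R * x ^+ k.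
Proof.
elim: N => [|N IH].
  by rewrite !big_ord0 mulr0 add0r addn0 bin_small// mul0r.
rewrite !big_ord_recr/= -IH addnS addSn binS natrD exprS; ring.
Qed.

Lemma geometric_sum_eq (A : comNzRingType) (x : A) N :
  (1 - x) * (\sum_(k < N) 'C(0 + k, 0)%:R * x ^+ k) = 1 - x ^+ N.
Proof.
elim: N => [|N IH]; first by rewrite big_ord0 mulr0 subrr.
by rewrite big_ord_recr/= mulrDr IH bin0 exprS; ring.
Qed.

Context {R : realType}.

Lemma negative_binomial_sum_le (r : R) m N : 0 <= r < 1 ->
  \sum_(k < N) 'C(m + k, m)%:R * r ^+ k <= (1 - r) ^- m.+1.
Proof.
move=> /andP[r0 r1]; have r10 : 0 < 1 - r by rewrite subr_gt0.
elim: m => [|m IH].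
  rewrite expr1 -(ler_pM2l r10) geometric_sum_eq mulfV ?gt_eqF// gerBl.
  exact: exprn_ge0.
rewrite -(ler_pM2l r10) exprS invfM mulrA mulfV ?gt_eqF// mul1r.
apply: le_trans IH; rewrite -(negative_binomial_recurrence r m) lerDl.
by rewrite mulr_ge0// exprn_ge0.
Qed.

(** These are the general terms of a series with nonnegative terms and bounded partial sums. *)
Lemma negative_binomial_term_cvg0 (r : R) m : 0 <= r < 1 ->
  'C(m + N, m)%:R * r ^+ N @[N --> \oo] --> (0 : R).
Proof.
move=> r01; have /andP[r0 r1] := r01.
apply: cvg_series_cvg_0; apply: nondecreasing_is_cvgn.
  apply/nondecreasing_seqP => k; rewrite /series/= big_nat_recr//= lerDl.
  by rewrite mulr_ge0// exprn_ge0.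
exists ((1 - r) ^- m.+1) => _ [N _ <-]; rewrite /series/= big_mkord.
exact: negative_binomial_sum_le.
Qed.

Lemma ccvg0P (u : nat -> R[i]) :
  normc (u k) @[k --> \oo] --> (0 : R) -> ccvg u 0.
Proof. by move=> u0; apply/ccvg_norm; under eq_fun do rewrite subr0. Qed.

Lemma negative_binomial_series (x : R[i]) m : (0 < m)%N -> normc x < 1 ->
  ccvg (fun N => \sum_(k < N) 'C(m.-1 + k, m.-1)%:R * x ^+ k) ((1 - x) ^+ m)^-1.
Proof.
case: m => // m _ x1 /=.
have x01 : 0 <= normc x < 1 by rewrite normc_ge0.
have x10 : 1 - x != 0.
  by apply: contraTneq x1 => /eqP; rewrite subr_eq0 => /eqP <-; rewrite Normc.normc1 ltxx.
have normn k : normc (k%:R : R[i]) = k%:R.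
  by rewrite -(rmorph_nat (real_complex R)) normc_real normr_nat.
elim: m => [|m IH].
  have -> : ((1 - x) ^+ 1)^-1 = (1 - x)^-1 * (1 + - 0) by rewrite oppr0 addr0 mulr1.
  have -> : (fun N => \sum_(k < N) 'C(0 + k, 0)%:R * x ^+ k) =
            (fun N => (1 - x)^-1 * (1 + (-1) * x ^+ N)).
    apply/funext => N; apply: (mulfI x10).
    by rewrite geometric_sum_eq mulrA mulfV// mul1r mulN1r.
  apply: ccvgM (ccvg_cst _) (ccvgD (ccvg_cst _) _).
  rewrite -[X in ccvg _ X]mulN1r; apply: ccvgM (ccvg_cst _) _.
  apply: ccvg0P; under eq_fun do rewrite normcX.
  apply: cvg_expr; rewrite ger0_norm ?normc_ge0//.
have -> : ((1 - x) ^+ m.+2)^-1 = (1 - x)^-1 * (((1 - x) ^+ m.+1)^-1 + (-1) * 0).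
  by rewrite mulr0 addr0 exprS invfM.
have -> : (fun N => \sum_(k < N) 'C(m.+1 + k, m.+1)%:R * x ^+ k) =
    (fun N => (1 - x)^-1 * (\sum_(k < N) 'C(m + k, m)%:R * x ^+ k
       + (-1) * ('C(m + N, m.+1)%:R * x ^+ N))).
  apply/funext => N; apply: (mulfI x10).
  by rewrite mulrA mulfV// mul1r -(negative_binomial_recurrence x m) mulN1r addrK.
apply: ccvgM (ccvg_cst _) (ccvgD IH (ccvgM (ccvg_cst _) _)).
apply: ccvg0P.
(* By Pascal's rule the boundary term is dominated in modulus by a term of the series one order
   higher, which tends to 0. *)
apply: (squeeze_cvgr _ (cvg_cst 0) (negative_binomial_term_cvg0 m.+1 x01)).
apply: nearW => N; rewrite normc_ge0 Normc.normcM normcX normn/=.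
rewrite ler_wpM2r ?exprn_ge0 ?normc_ge0// ler_nat.
by rewrite addSn binS leq_addr.
Qed.

End negative_binomial_series.

Section box.
Context (d : nat).

(** Cubes of multi-indices are chosen as the exhausting sets because a sum of products over a cube
    is a product of one-variable sums, so only one-variable limits are needed. *)
Definition box N : seq {ffun 'I_d -> nat} :=
  [seq [ffun j => val (b j)] | b : {ffun 'I_d -> 'I_N}].

Lemma box_uniq N : uniq (box N).
Proof.
rewrite map_inj_uniq ?enum_uniq// => b c /ffunP bc; apply/ffunP => j.
by have := bc j; rewrite !ffunE => /val_inj.
Qed.

Lemma mem_box N (a : {ffun 'I_d -> nat}) : reflect (forall j, (a j < N)%N) (a \in box N).
Proof.
apply: (iffP mapP) => [[b _ ->] j|aN].
  by rewrite ffunE; exact: ltn_ord.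
exists [ffun j => Ordinal (aN j)]; first by rewrite mem_enum.
by apply/ffunP => j; rewrite !ffunE.
Qed.

Lemma box_sub N M : (N <= M)%N -> {subset box N <= box M}.
Proof.
by move=> NM a /mem_box aN; apply/mem_box => j; exact: leq_trans (aN j) NM.
Qed.

Lemma big_box_prod (A : comNzRingType) N (g : 'I_d -> nat -> A) :
  \sum_(a <- box N) \prod_j g j (a j) = \prod_j \sum_(k < N) g j k.
Proof.
rewrite bigA_distr_bigA/= /box big_map big_enum/=.
by apply: eq_bigr => b _; apply: eq_bigr => j _; rewrite ffunE.
Qed.

End box.

Section hartogs_kernel_expansion.
Context {R : realType} (n : nat).
Implicit Types (z w : 'rV[R[i]]_n.+1) (m : 'I_n.+1 -> nat).

(* The coordinate with index [n.+1] is [1]: the defining inequalities of the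
   Hartogs triangle then all read |z_j| < |z_(j+1)|. *)
Definition hcoord z (k : nat) : R[i] := oapp (z 0) 1 (insub k).

Lemma hcoord_ord z (j : 'I_n.+1) : hcoord z j = z 0 j.
Proof. by rewrite /hcoord valK. Qed.

Lemma hcoord_max z : hcoord z n.+1 = 1.
Proof. by rewrite /hcoord insubF// ltnn. Qed.

Lemma hcoordS z (k : 'I_n) : hcoord z k.+1 = cr z k.
Proof. exact: hcoord_ord z (lift ord0 k). Qed.

Definition hratio z (j : 'I_n.+1) : R[i] := z 0 j / hcoord z j.+1.

Lemma hratio_cl z (k : 'I_n) : hratio z (widen_ord (leqnSn n) k) = cl z k / cr z k.
Proof. by rewrite /hratio hcoordS. Qed.

Lemma hratio_max z : hratio z ord_max = z 0 ord_max.
Proof. by rewrite /hratio hcoord_max divr1. Qed.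

Lemma hartogsP z : hartogs R n z <->
  (forall j : 'I_n.+1, normc (hcoord z j) < normc (hcoord z j.+1)).
Proof.
split=> [[zj z1] j|zj].
  have [jn|nj] := ltnP j n.
    by have := zj (Ordinal jn); rewrite /cl -hcoordS -hcoord_ord.
  have -> : j = ord_max by apply/val_inj/eqP; rewrite eqn_leq nj -ltnS ltn_ord.
  by rewrite hcoord_max hcoord_ord Normc.normc1.
split=> [k|]; last by have := zj ord_max; rewrite hcoord_max hcoord_ord Normc.normc1.
by have := zj (widen_ord (leqnSn n) k); rewrite hcoordS hcoord_ord.
Qed.

Lemma hartogs_coord_neq0 z (j : 'I_n.+1) : hartogs R n z -> hcoord z j.+1 != 0.
Proof.
by move=> /hartogsP/(_ j) zj; rewrite -normc_gt0 (le_lt_trans (normc_ge0 _) zj).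
Qed.

Lemma hartogs_hratio_lt1 z j : hartogs R n z -> normc (hratio z j) < 1.
Proof.
move=> Dz; rewrite /hratio Normc.normcM Normc.normcV ltr_pdivrMr ?mul1r.
  by have /hartogsP/(_ j) := Dz; rewrite hcoord_ord.
by rewrite normc_gt0 hartogs_coord_neq0.
Qed.

Lemma hartogs_kernelE m z w : hartogs_kernel m z w =
  (\prod_(k < n) cr z k)^-1 * ((\prod_(k < n) cr w k)^-1)^* *
  \prod_j ((1 - hratio z j * (hratio w j)^*) ^+ m j)^-1.
Proof.
rewrite /hartogs_kernel -mulrA; congr (_ * _).
  by rewrite fmorphV rmorph_prod -invfM -big_split prodfV.
rewrite big_ord_recr/= !hratio_max; congr (_ * _).
apply: eq_bigr => k _; by rewrite !hratio_cl fmorph_div/= mulf_div.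
Qed.

(** The constant [c_a] of the expansion: the coefficient of the power [a] in the product of the
    series of (1 - x_j)^(- m_j). *)
Definition coefc m (a : {ffun 'I_n.+1 -> nat}) : R :=
  \prod_j 'C((m j).-1 + a j, (m j).-1)%:R.

Lemma coefc_gt0 m a : 0 < coefc m a.
Proof. by apply: prodr_gt0 => j _; rewrite ltr0n bin_gt0 leq_addr. Qed.

Definition monom (a : {ffun 'I_n.+1 -> nat}) z : R[i] :=
  (\prod_(k < n) cr z k)^-1 * \prod_j hratio z j ^+ a j.

(* The functions e_a of the header. *)
Definition hbasis m a z : R[i] := (Num.sqrt (coefc m a))%:C%C * monom a z.

Lemma hartogs_kernel_expansion m : (forall j, (0 < m j)%N) ->
  forall z w, hartogs R n z -> hartogs R n w ->
  ccvg (fun N => \sum_(a <- box n.+1 N) hbasis m a z * (hbasis m a w)^*)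
       (hartogs_kernel m z w).
Proof.
move=> m0 z w Dz Dw; rewrite hartogs_kernelE.
under [X in ccvg X]eq_fun.
  move=> N.
  have -> : \sum_(a <- box n.+1 N) hbasis m a z * (hbasis m a w)^* =
      (\prod_(k < n) cr z k)^-1 * ((\prod_(k < n) cr w k)^-1)^* *
      \prod_j \sum_(k < N) 'C((m j).-1 + k, (m j).-1)%:R *
                           (hratio z j * (hratio w j)^*) ^+ k.
    rewrite -(big_box_prod N (fun j k => 'C((m j).-1 + k, (m j).-1)%:R *
                           (hratio z j * (hratio w j)^*) ^+ k)) mulr_sumr; apply: eq_bigr => a _.
    rewrite /hbasis /monom !rmorphM/= rmorph_prod/= big_split/=.
    have cE : \prod_j 'C((m j).-1 + a j, (m j).-1)%:R = (coefc m a)%:C%C.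
      by rewrite rmorph_prod; apply: eq_bigr => j _; rewrite rmorph_nat.
    rewrite [in RHS]cE.
    rewrite [LHS](_ : _ = (Num.sqrt (coefc m a))%:C%C * ((Num.sqrt (coefc m a))%:C%C)^* *
       ((\prod_(k < n) cr z k)^-1 * ((\prod_(k < n) cr w k)^-1)^* *
       (\prod_j hratio z j ^+ a j * \prod_j (hratio w j ^+ a j)^*))); last by ring.
    rewrite mulcJ normc_real real_normK ?num_real// sqr_sqrtr ?(ltW (coefc_gt0 _ _))//.
    rewrite mulrCA; congr (_ * (_ * _)); rewrite -big_split/=.
    by apply: eq_bigr => j _; rewrite rmorphXn -exprMn.
  over.
apply: ccvgM (ccvg_cst _) _; apply: ccvg_prod => j.
apply: negative_binomial_series => //.
rewrite Normc.normcM normc_conj -[ltRHS]mulr1.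
by rewrite ltr_pM ?normc_ge0// hartogs_hratio_lt1.
Qed.

End hartogs_kernel_expansion.

(** * Tonelli for tuple measures, complex measurability *)

Section tuple_measure_tonelli.
Local Open Scope ereal_scope.
Context d (T : measurableType d) (R : realType).
Context (mu : {sigma_finite_measure set T -> \bar R}) (n : nat).
Variable F : n.+1.-tuple T -> \bar R.
Hypotheses (mF : measurable_fun setT F) (F0 : forall t, 0 <= F t).

Local Notation nu := (tuple_measure mu n).

Let mFc : measurable_fun setT (F \o @tcons _ T n).
Proof. by apply: measurableT_comp => //; exact: measurable_tcons. Qed.

Lemma measurable_integral_tail :
  measurable_fun setT (fun x => \int[nu]_t F (tcons (x, t))).
Proof. exact: (@measurable_fun_fubini_tonelli_F _ _ _ _ R nu _ mFc (fun x => F0 (tcons x))). Qed.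

Let integral_pushforward_tcons : \int[tuple_measure mu n.+1]_t F t =
  \int[mu \x nu]_x F (tcons x).
Proof.
transitivity (\int[pushforward (sf_product mu nu) (@tcons _ T n)]_t F t) => //.
by rewrite ge0_integral_pushforward//; exact: measurable_tcons.
Qed.

Lemma integral_tuple_measure_head_tail : \int[tuple_measure mu n.+1]_t F t =
  \int[mu]_x \int[nu]_t F (tcons (x, t)).
Proof.
by rewrite integral_pushforward_tcons
  (@fubini_tonelli1 _ _ _ _ R mu nu _ mFc (fun x => F0 (tcons x))).
Qed.

Lemma integral_tuple_measure_tail_head : \int[tuple_measure mu n.+1]_t F t =
  \int[nu]_t \int[mu]_x F (tcons (x, t)).
Proof.
by rewrite integral_pushforward_tcons
  (@fubini_tonelli2 _ _ _ _ R mu nu _ mFc (fun x => F0 (tcons x))).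
Qed.

End tuple_measure_tonelli.

Section complex_measurability.
Context d (T : measurableType d) (R : realType).
Implicit Types (D : set T) (f g : T -> R[i]).

Definition cmeasurable D f :=
  measurable_fun D (fun x => Re (f x)) /\ measurable_fun D (fun x => Im (f x)).

(** Writing the inverse as [f x] times the power -1 of [f x ^+ 2] reduces to measurability of
    [powR]; where [f] vanishes both sides are 0. *)
Lemma measurable_funV D (f : T -> R) :
  measurable_fun D f -> measurable_fun D (fun x => (f x)^-1).
Proof.
move=> mf; have -> : (fun x => (f x)^-1) = (fun x => f x * powR (f x ^+ 2) (-1)).
  apply/funext => x; rewrite powR_inv1 ?sqr_ge0//.
  have [->|fx0] := eqVneq (f x) 0; first by rewrite invr0 mul0r.
  by rewrite expr2 invfM mulrA mulfV// mul1r.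
apply: measurable_funM => //.
exact: (measurableT_comp (measurable_powR (-1)) (measurable_funX 2 mf)).
Qed.

Lemma cmeasurable_cst D c : cmeasurable D (fun=> c).
Proof. by split; exact: measurable_cst. Qed.

Lemma cmeasurable_complex D (f g : T -> R) : measurable_fun D f ->
  measurable_fun D g -> cmeasurable D (fun x => Complex (f x) (g x)).
Proof. by []. Qed.

Lemma cmeasurableD D f g :
  cmeasurable D f -> cmeasurable D g -> cmeasurable D (fun x => f x + g x).
Proof.
move=> [fr fi] [gr gi]; split.
  by under eq_fun do rewrite cReD; exact: measurable_funD.
by under eq_fun do rewrite cImD; exact: measurable_funD.
Qed.

Lemma cmeasurableM D f g :
  cmeasurable D f -> cmeasurable D g -> cmeasurable D (fun x => f x * g x).
Proof.
move=> [fr fi] [gr gi]; split.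
  by under eq_fun do rewrite cReM; apply: measurable_funB; exact: measurable_funM.
by under eq_fun do rewrite cImM; apply: measurable_funD; exact: measurable_funM.
Qed.

Lemma measurable_normc2 D f :
  cmeasurable D f -> measurable_fun D (fun x => normc (f x) ^+ 2).
Proof.
move=> [fr fi]; under eq_fun do rewrite normc2E.
by apply: measurable_funD; exact: measurable_funX.
Qed.

Lemma measurable_normc D f :
  cmeasurable D f -> measurable_fun D (fun x => normc (f x)).
Proof.
move=> /measurable_normc2 mf.
under eq_fun => x do rewrite -[normc _]ger0_norm ?normc_ge0// -sqrtr_sqr.
apply: measurableT_comp mf; apply: continuous_measurable_fun.
exact: sqrt_continuous.
Qed.

Lemma cinvE (z : R[i]) : z^-1 = Complex (Re z / normc z ^+ 2) (- Im z / normc z ^+ 2).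
Proof.
by rewrite normc2E; case: z => a b /=; apply: complex_eqP => //=; rewrite mulNr.
Qed.

Lemma cmeasurableV D f : cmeasurable D f -> cmeasurable D (fun x => (f x)^-1).
Proof.
move=> mf; have mn := measurable_funV (measurable_normc2 mf); case: mf => fr fi.
under [X in cmeasurable _ X]eq_fun do rewrite cinvE.
apply: cmeasurable_complex; apply: measurable_funM => //.
exact: measurableT_comp.
Qed.

Lemma cmeasurable_sum I (r : seq I) D (f : I -> T -> R[i]) :
  (forall i, cmeasurable D (f i)) -> cmeasurable D (fun x => \sum_(i <- r) f i x).
Proof.
move=> mf; elim: r => [|i r IH].
  by under [X in cmeasurable _ X]eq_fun do rewrite big_nil; exact: cmeasurable_cst.
under [X in cmeasurable _ X]eq_fun do rewrite big_cons.
exact: cmeasurableD.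
Qed.

Lemma cmeasurable_prod I (r : seq I) D (f : I -> T -> R[i]) :
  (forall i, cmeasurable D (f i)) -> cmeasurable D (fun x => \prod_(i <- r) f i x).
Proof.
move=> mf; elim: r => [|i r IH].
  by under [X in cmeasurable _ X]eq_fun do rewrite big_nil; exact: cmeasurable_cst.
under [X in cmeasurable _ X]eq_fun do rewrite big_cons.
exact: cmeasurableM.
Qed.

Lemma cmeasurableX D f k : cmeasurable D f -> cmeasurable D (fun x => f x ^+ k).
Proof.
move=> mf; elim: k => [|k IH].
  by under [X in cmeasurable _ X]eq_fun do rewrite expr0; exact: cmeasurable_cst.
under [X in cmeasurable _ X]eq_fun do rewrite exprS.
exact: cmeasurableM.
Qed.

Lemma cmeasurable_cvg D (u : nat -> T -> R[i]) f :
  (forall k, cmeasurable D (u k)) ->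
  (forall x, D x -> ccvg (fun k => u k x) (f x)) -> cmeasurable D f.
Proof.
move=> mu uf; split.
  by apply: (measurable_fun_cvg (fun k => (mu k).1)) => x /uf[].
by apply: (measurable_fun_cvg (fun k => (mu k).2)) => x /uf[].
Qed.

End complex_measurability.

(** * Characters of the circle *)

Section cexp.
Context {R : realType}.
Implicit Types x y : R.

Definition cexp x : R[i] := Complex (cos x) (sin x).

Lemma cexp0 : cexp 0 = 1.
Proof. by rewrite /cexp cos0 sin0. Qed.

Lemma cexpD x y : cexp (x + y) = cexp x * cexp y.
Proof. by apply: complex_eqP; rewrite ?(cReM, cImM)/= ?cosD ?sinD//; ring. Qed.

Lemma cexpJ x : (cexp x)^* = cexp (- x).
Proof. by rewrite conjE /cexp cosN sinN. Qed.

Lemma normc_cexp x : normc (cexp x) = 1.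
Proof. by rewrite /= cos2Dsin2 sqrtr1. Qed.

Lemma cexp_neq0 x : cexp x != 0.
Proof. by rewrite -normc_gt0 normc_cexp. Qed.

Lemma cexpV x : (cexp x)^-1 = cexp (- x).
Proof. by apply: (mulfI (cexp_neq0 x)); rewrite mulfV ?cexp_neq0// -cexpD subrr cexp0. Qed.

Lemma cexp_exprz x (k : int) : cexp x ^ k = cexp (k%:~R * x).
Proof.
have cexpX p : cexp x ^+ p = cexp (p%:R * x).
  elim: p => [|p IH]; first by rewrite mul0r cexp0.
  by rewrite exprS IH -cexpD mulrS mulrDl mul1r.
case: k => p; first by rewrite -exprnP cexpX.
by rewrite NegzE -exprnN cexpX cexpV rmorphN/= mulNr.
Qed.

Lemma cexp_2pi (k : int) : cexp (k%:~R * (2 * pi)) = 1.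
Proof.
rewrite -cexp_exprz (_ : cexp _ = 1) ?exp1rz//.
by rewrite /cexp mulr_natl cos2pi sin2pi.
Qed.

Lemma measurable_cexp : cmeasurable (setT : set (measurableTypeR R)) cexp.
Proof.
by split; apply: continuous_measurable_fun;
  [exact: continuous_cos|exact: continuous_sin].
Qed.

End cexp.

(** * Parseval on the torus *)

Section torus.
Context {R : realType}.
Local Notation mu := (@lebesgue_measure R).

Definition cube n : set (n.-tuple (measurableTypeR R)) :=
  [set t | forall j, (tnth t j : R) \in `[0, 2 * pi]%R].

Lemma measurable_cube n : measurable (@cube n).
Proof.
rewrite (_ : @cube n = \bigcap_(i in [set: 'I_n])
    ((fun t => tnth t i) @^-1` [set` `[0, 2 * pi]%R])).
  apply: fin_bigcap_measurable => // i _; rewrite -[X in measurable X]setTI.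
  by apply: measurable_tnth => //; exact: measurable_itv.
by apply/seteqP; split => t /= At i; [move=> _|]; exact: At.
Qed.

Lemma integral_cube_cons n (F : n.+1.-tuple (measurableTypeR R) -> \bar R) :
  measurable_fun setT F -> (forall t, (0 <= F t)%E) ->
  (\int[lebesgue_Rn R n.+1]_(t in @cube n.+1) F t =
   \int[mu]_(x in [set` `[0, 2 * pi]%R])
      \int[lebesgue_Rn R n]_(t in @cube n) F (tcons (x, t)))%E.
Proof.
move=> mF F0; rewrite integral_mkcond integral_tuple_measure_head_tail; last 2 first.
- apply/(@measurable_restrict _ _ _ _ _ _ _ (@measurable_cube _) measurableT).
  exact: measurable_funS mF.
- by move=> t; rewrite patchE; case: ifP.
rewrite [RHS]integral_mkcond; apply: eq_integral => x _; rewrite patchE.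
case: ifPn => [/set_mem/= x01|/negP x01].
  rewrite [RHS]integral_mkcond; apply: eq_integral => t _; rewrite !patchE.
  congr (if _ then _ else _); apply/idP/idP; rewrite !inE/= => ct j.
    by have := ct (lift ord0 j); rewrite tnthS.
  by case: (unliftP ord0 j) => [k|] ->; rewrite ?tnthS.
apply: integral0_eq => t _; rewrite patchE; case: ifPn => //; rewrite inE => ct.
by exfalso; apply: x01; rewrite inE; exact: (ct ord0).
Qed.

Lemma continuous_ReM_cexp (C : R[i]) (r : R) (k : int) :
  continuous (fun x : R => r + Re (C * cexp (k%:~R * x))).
Proof.
move=> x; under eq_fun do rewrite cReM/=.
apply: cvgD; first exact: cvg_cst.
apply: cvgB; apply: cvgMr.
  exact: (continuous_comp (@mulrl_continuous _ _ _) (@continuous_cos _ _)).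
exact: (continuous_comp (@mulrl_continuous _ _ _) (@continuous_sin _ _)).
Qed.

(** The primitive [G] divides by [k], hence the separate case [k = 0]. Otherwise its trigonometric
    part takes equal values at both endpoints and only the constant [r] contributes. *)
Lemma integral_cexp (C : R[i]) (r : R) (k : int) : normc C <= r ->
  (\int[mu]_(x in [set` `[0, 2 * pi]%R]) (r + Re (C * cexp (k%:~R * x)))%:E =
  (2 * pi * (r + Re C *+ (k == 0)))%:E)%E.
Proof.
move=> Cr; have pi20 : 0 < 2 * pi :> R by rewrite mulr_gt0// pi_gt0.
have [->|k0] := eqVneq k 0.
  under eq_integral do rewrite mul0r cexp0 mulr1.
  rewrite integral_cst//= lebesgue_measure_itv/= lte_fin pi20 -EFinD subr0 -EFinM.
  by rewrite mulrC.
have kR0 : k%:~R != 0 :> R by rewrite intr_eq0.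
pose G (x : R) : R := r * x + (Re C * sin (k%:~R * x) + Im C * cos (k%:~R * x)) / k%:~R.
have dG (x : R) : is_derive x 1 G (r + Re (C * cexp (k%:~R * x))).
  have E1 : is_derive x 1 (fun y : R => k%:~R * y) k%:~R.
    by apply: is_derive_eq; rewrite /GRing.scale/= mulr1.
  have E2 : is_derive x 1 (sin \o (fun y : R => k%:~R * y)) (cos (k%:~R * x) * k%:~R).
    exact: is_derive1_comp.
  have E3 : is_derive x 1 (cos \o (fun y : R => k%:~R * y)) (- sin (k%:~R * x) * k%:~R).
    exact: is_derive1_comp.
  apply: is_derive_eq.
  by rewrite /GRing.scale/= cReM/=; field.
have cG : continuous G.
  by move=> x; apply/differentiable_continuous/derivable1_diffP/ex_derive.
rewrite (@continuous_FTC2 _ _ G)//.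
- rewrite -EFinB /G !mulr0 sin0 cos0 add0r.
  have -> : cos (k%:~R * (2 * pi)) = 1 :> R by have /(congr1 (@complex.Re R)) := @cexp_2pi R k.
  have -> : sin (k%:~R * (2 * pi)) = 0 :> R by have /(congr1 (@complex.Im R)) := @cexp_2pi R k.
  by rewrite mulr0 addr0 add0r addrK [r * _]mulrC.
- exact/continuous_subspaceT/continuous_ReM_cexp.
- split.
  + by move=> x _; apply: ex_derive.
  + by apply: cvg_at_right_filter; exact: cG.
  + by apply: cvg_at_left_filter; exact: cG.
- by move=> x _; rewrite derive1E; apply: derive_val.
Qed.

Lemma cmeasurable_character n (D : set (n.-tuple (measurableTypeR R)))
    (k : 'I_n -> int) :
  cmeasurable D (fun t => \prod_j cexp ((k j)%:~R * tnth t j)).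
Proof.
apply: cmeasurable_prod => j; have [mr mi] := @measurable_cexp R.
have mt : measurable_fun D (fun t : n.-tuple (measurableTypeR R) => (k j)%:~R * tnth t j : R).
  apply: measurable_funM; first exact: measurable_cst.
  by apply: measurable_funS (measurable_tnth j).
by split; [exact: measurableT_comp mr mt|exact: measurableT_comp mi mt].
Qed.

Lemma normc_character n (t : n.-tuple (measurableTypeR R)) (k : 'I_n -> int) :
  normc (\prod_j cexp ((k j)%:~R * tnth t j)) = 1.
Proof. by rewrite normc_prod big1// => j _; rewrite normc_cexp. Qed.

Lemma measurable_ReM_character n (D : set (n.-tuple (measurableTypeR R)))
    (C : R[i]) (r : R) (k : 'I_n -> int) :
  measurable_fun D (fun t => (r + Re (C * \prod_j cexp ((k j)%:~R * tnth t j)))%:E).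
Proof.
apply/measurable_EFinP; apply: measurable_funD; first exact: measurable_cst.
by have [] := cmeasurableM (cmeasurable_cst D C) (cmeasurable_character D k).
Qed.

Lemma ReM_character_ge0 n (C : R[i]) (r : R) (k : 'I_n -> int)
    (t : n.-tuple (measurableTypeR R)) : normc C <= r ->
  0 <= r + Re (C * \prod_j cexp ((k j)%:~R * tnth t j)).
Proof.
move=> Cr; set z := C * _; rewrite -lerBlDl sub0r.
suff : `|Re z| <= r by rewrite ler_norml => /andP[].
rewrite (le_trans (ler_Re_normc _))// Normc.normcM normc_character.
by rewrite mulr1.
Qed.

(* Adding [r >= |C|] makes the integrand nonnegative, so that Tonelli applies. *)
Lemma integral_cube_cexp n (C : R[i]) (r : R) (k : 'I_n -> int) : normc C <= r ->
  (\int[lebesgue_Rn R n]_(t in @cube n)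
     (r + Re (C * \prod_j cexp ((k j)%:~R * tnth t j)))%:E =
  ((2 * pi) ^+ n * (r + Re C *+ [forall j, k j == 0]))%:E)%E.
Proof.
elim: n C k => [|n IH] C k Cr.
  rewrite integral_dirac/=; [|exact: measurable_cube|exact: measurable_ReM_character].
  rewrite diracE mem_set ?mul1e; last by case.
  rewrite big_ord0 mulr1 expr0 mul1r.
  by rewrite (_ : [forall j, _])//; apply/forallP; case.
rewrite integral_cube_cons; last 2 first.
- exact: measurable_ReM_character.
- by move=> t; rewrite lee_fin ReM_character_ge0.
(* Integrating over the tail leaves the amplitude when all tail frequencies vanish and 0 otherwise;
   [C *+ b] is the amplitude for the remaining variable. *)
pose b := [forall j, k (lift ord0 j) == 0].
have Cbr : normc (C *+ b) <= r.
  by case: b => //; rewrite Normc.normc0 (le_trans (normc_ge0 _) Cr).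
transitivity (\int[mu]_(x in [set` `[0, 2 * pi]%R])
    (((2 * pi) ^+ n)%:E * (r + Re (C *+ b * cexp ((k ord0)%:~R * x)))%:E))%E.
  apply: eq_integral => x _; rewrite -EFinM.
  have -> : Re (C *+ b * cexp ((k ord0)%:~R * x)) =
            Re (C * cexp ((k ord0)%:~R * x)) *+ b.
    by case: b {Cbr} => //; rewrite mulr0n mul0r.
  rewrite -IH; last by rewrite Normc.normcM normc_cexp mulr1.
  apply: eq_integral => t _; rewrite big_ord_recl mulrA.
  congr (_ + Re (_ * _))%:E.
  by apply: eq_bigr => j _; rewrite tnthS.
rewrite ge0_integralZl//=; last 3 first.
- have mc := continuous_measurable_fun (@continuous_ReM_cexp (C *+ b) r (k ord0)).
  by apply/measurable_EFinP; exact: measurable_funTS mc.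
- move=> x _; rewrite lee_fin.
  have := ReM_character_ge0 (fun _ : 'I_1 => k ord0) [tuple x] Cbr.
  by rewrite big_ord1.
- by rewrite lee_fin exprn_ge0// mulr_ge0// pi_ge0.
rewrite integral_cexp// -EFinM exprSr -[in RHS]mulrA; congr (_ * (_ * (_ + _)))%:E.
rewrite (_ : [forall j, k j == 0] = (k ord0 == 0) && b).
  by case: b {Cbr}; case: eqP; rewrite ?mulr0n ?mul0rn.
apply/forallP/andP => [kj|[k0 /forallP kj] j]; first by split=> //; apply/forallP.
by case: (unliftP ord0 j) => [i|] ->.
Qed.

Lemma normc2_sum (T : Type) (r : seq T) (F : T -> R[i]) :
  normc (\sum_(a <- r) F a) ^+ 2 =
  \sum_(a <- r) \sum_(b <- r) Re (F a * (F b)^*).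
Proof.
have -> : normc (\sum_(a <- r) F a) ^+ 2 =
  Re ((\sum_(a <- r) F a) * (\sum_(a <- r) F a)^*) by rewrite mulcJ.
rewrite rmorph_sum mulr_suml cRe_sum; apply: eq_bigr => a _.
by rewrite mulr_sumr cRe_sum.
Qed.

(** Expanding the square gives a double sum of characters whose off-diagonal frequencies are
    nonzero. To integrate term by term as nonnegative functions, each term is raised by its modulus;
    the total [s] is subtracted at the end. *)
Lemma torus_parseval n (T : eqType) (r : seq T) (A : T -> R[i])
    (k : T -> 'I_n -> int) : uniq r ->
  {in r &, forall a b, (forall j, k a j = k b j) -> a = b} ->
  (\int[lebesgue_Rn R n]_(t in @cube n)
     (normc (\sum_(a <- r) A a * \prod_j cexp ((k a j)%:~R * tnth t j)) ^+ 2)%:E =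
  ((2 * pi) ^+ n * sqsum r A)%:E)%E.
Proof.
move=> ur kinj; pose F (t : n.-tuple (measurableTypeR R)) : R[i] :=
  \sum_(a <- r) A a * \prod_j cexp ((k a j)%:~R * tnth t j).
pose c a b := normc (A a * (A b)^*).
pose h a b (t : n.-tuple (measurableTypeR R)) : R := c a b + Re (A a * (A b)^* *
  \prod_j cexp ((k a j - k b j)%:~R * tnth t j)).
pose s : R := \sum_(a <- r) \sum_(b <- r) c a b.
have s0 : 0 <= s by apply: sumr_ge0 => a _; apply: sumr_ge0 => b _; exact: normc_ge0.
have mh a b : measurable_fun (@cube n) (fun t => (h a b t)%:E).
  exact: measurable_ReM_character.
have mh' a b : measurable_fun (@cube n) (h a b).
  by apply/measurable_EFinP; exact: mh.
have h0 a b t : (0 <= (h a b t)%:E)%E by rewrite lee_fin; exact: ReM_character_ge0.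
have FE t : normc (F t) ^+ 2 + s = \sum_(a <- r) \sum_(b <- r) h a b t.
  rewrite normc2_sum /s -big_split/=; apply: eq_bigr => a _.
  rewrite -big_split/=; apply: eq_bigr => b _; rewrite addrC; congr (_ + Re _).
  rewrite rmorphM/= mulrACA; congr (_ * _); rewrite rmorph_prod -big_split/=.
  by apply: eq_bigr => j _; rewrite cexpJ -cexpD rmorphB/= mulrBl.
have mF : measurable_fun (@cube n) (fun t => (normc (F t) ^+ 2)%:E).
  apply/measurable_EFinP/measurable_normc2/cmeasurable_sum => a.
  exact: cmeasurableM (cmeasurable_cst _ _) (cmeasurable_character _ _).
have inth a b : (\int[lebesgue_Rn R n]_(t in @cube n) (h a b t)%:E =
    ((2 * pi) ^+ n * (c a b + Re (A a * (A b)^*) *+ [forall j, k a j - k b j == 0]))%:E)%E.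
  by apply: integral_cube_cexp.
have mcube := @measurable_cube n.
have int1 : (\int[lebesgue_Rn R n]_(t in @cube n) (normc (F t) ^+ 2 + s)%:E =
    ((2 * pi) ^+ n * (s + sqsum r A))%:E)%E.
  under eq_integral do rewrite FE -sumEFin.
  rewrite ge0_integral_sum//; last 2 first.
  - by move=> a; apply/measurable_EFinP/measurable_sum => b; exact: mh'.
  - by move=> a t _; rewrite lee_fin; apply: sumr_ge0 => b _; rewrite -lee_fin.
  rewrite /s /sqsum -big_split/= mulr_sumr -sumEFin !big_seq; apply: eq_bigr => a ar.
  under eq_integral do rewrite -sumEFin.
  rewrite ge0_integral_sum//.
  rewrite (eq_bigr _ (fun b _ => inth a b)).
  rewrite sumEFin -mulr_sumr big_split/=; congr (_ * (_ + _))%:E.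
  rewrite (bigD1_seq a)//= big1_seq => [|b /andP[ba br]].
    rewrite addr0 mulcJ (_ : [forall j, _]) ?mulr1n//.
    by apply/forallP => j; rewrite subrr.
  rewrite (_ : [forall j, _] = false) ?mulr0n//.
  apply: contraNF ba => /forallP kab; apply/eqP; apply: kinj => // j.
  by apply/esym/eqP; rewrite -subr_eq0.
have int2 : (\int[lebesgue_Rn R n]_(t in @cube n) s%:E = ((2 * pi) ^+ n * s)%:E)%E.
  have := @integral_cube_cexp n 0 s (fun=> 0); rewrite Normc.normc0 => /(_ s0).
  rewrite mul0rn addr0 => <-.
  by apply: eq_integral => t _; rewrite mul0r addr0.
move: int1; under eq_integral do rewrite EFinD.
rewrite ge0_integralD//=; last by move=> t _; rewrite lee_fin sqr_ge0.
rewrite int2 (_ : (2 * pi) ^+ n * (s + _) = (2 * pi) ^+ n * sqsum r A + (2 * pi) ^+ n * s).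
  rewrite EFinD => /(congr1 (fun x => x - ((2 * pi) ^+ n * s)%:E)%E).
  by rewrite !addeK.
by rewrite mulrDr addrC.
Qed.


End torus.

(** * Averages over the torus action *)

Section rotation.
Context {R : realType} (n : nat).
Implicit Types (z w : 'rV[R[i]]_n.+1) (a : {ffun 'I_n.+1 -> nat}).

Definition mulv z w : 'rV[R[i]]_n.+1 := \row_j (z 0 j * w 0 j).

Lemma hcoord_mulv z w k : hcoord (mulv z w) k = hcoord z k * hcoord w k.
Proof. by rewrite /hcoord; case: insubP => [j _ _|_] /=; rewrite ?mxE ?mulr1. Qed.

Lemma monom_mulv a z w : monom a (mulv z w) = monom a z * monom a w.
Proof.
rewrite /monom mulrACA -invfM -!big_split/=; congr (_^-1 * _).
  by apply: eq_bigr => k _; rewrite -!hcoordS hcoord_mulv.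
by apply: eq_bigr => j _; rewrite -exprMn /hratio hcoord_mulv mxE invfM mulrACA.
Qed.

(** The exponent of the coordinate [j] in the Laurent monomial [monom a]: [a j] from its own ratio
    and, for [j > 0], minus [a (j - 1)] from the preceding ratio and minus 1 from the prefactor. *)
Definition freq a (j : 'I_n.+1) : int :=
  (a j)%:Z - oapp (fun k : 'I_n => (a (widen_ord (leqnSn n) k)).+1%:Z) 0 (unlift ord0 j).

(** The system is triangular: the first frequency is [a] at 0, and each next one determines the next
    entry. *)
Lemma freq_inj a b : (forall j, freq a j = freq b j) -> a = b.
Proof.
move=> ab; apply/ffunP => -[j jn]; elim: j jn => [|j IH] jn.
  have := ab ord0; rewrite /freq unlift_none/= !subr0 => -[].
  by rewrite (_ : Ordinal jn = ord0)//; exact/val_inj.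
have jn' : (j < n)%N by rewrite -ltnS.
have := ab (lift ord0 (Ordinal jn')); rewrite /freq liftK/=.
rewrite (_ : widen_ord _ _ = Ordinal (ltnW jn)); last exact/val_inj.
rewrite (_ : lift _ _ = Ordinal jn); last exact/val_inj.
by rewrite IH => /addIr[].
Qed.

Lemma monom_freq a z : (forall j, z 0 j != 0) -> monom a z = \prod_j z 0 j ^ freq a j.
Proof.
move=> z0; rewrite /monom.
under eq_bigr do rewrite /hratio exprMn exprVn.
rewrite big_split/= [X in _ * (_ * X)]big_ord_recr/= hcoord_max expr1n invr1 mulr1.
rewrite big_ord_recl [RHS]big_ord_recl {1}/freq unlift_none/= subr0 -exprnP.
rewrite mulrCA -!mulrA; congr (_ * _); rewrite -prodfV -!big_split/=.
apply: eq_bigr => k _; rewrite /freq liftK/= hcoordS /cr.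
by rewrite expfzDr// -exprnP -exprnN exprS invfM mulrCA [X in _ * X]mulrC.
Qed.

Definition circle_row (t : n.+1.-tuple (measurableTypeR R)) : 'rV[R[i]]_n.+1 :=
  \row_j cexp (tnth t j).

Definition trot t z := mulv (circle_row t) z.

(** Multiplicativity isolates the unit factor, and the Laurent form is applied to that factor only;
    so [z] may have zero coordinates. *)
Lemma monom_rot a t z : monom a (trot t z) =
  monom a z * \prod_j cexp ((freq a j)%:~R * tnth t j).
Proof.
rewrite monom_mulv mulrC [monom a (circle_row t)]monom_freq => [|j]; last by rewrite mxE cexp_neq0.
by congr (_ * _); apply: eq_bigr => j _; rewrite mxE cexp_exprz.
Qed.

Lemma normc_coord_rot t z k : normc (hcoord (trot t z) k) = normc (hcoord z k).
Proof.
rewrite hcoord_mulv Normc.normcM /hcoord; case: insubP => [j _ _|_].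
  by rewrite /oapp mxE normc_cexp mul1r.
by rewrite /oapp Normc.normc1 mul1r.
Qed.

Lemma hartogs_rot t z : hartogs R n (trot t z) <-> hartogs R n z.
Proof.
by split=> /hartogsP zj; apply/hartogsP => j; have := zj j; rewrite !normc_coord_rot.
Qed.

Lemma hbasis_rot m a t z : hbasis m a (trot t z) =
  hbasis m a z * \prod_j cexp ((freq a j)%:~R * tnth t j).
Proof. by rewrite /hbasis monom_rot mulrA. Qed.

Lemma normc_hbasis_rot m a t z : normc (hbasis m a (trot t z)) = normc (hbasis m a z).
Proof. by rewrite hbasis_rot Normc.normcM normc_character mulr1. Qed.

End rotation.

Section hartogs_expansion.
Context {R : realType} (n : nat) (m : 'I_n.+1 -> nat) (H : hartogs_space R n m) (f : H).
Hypothesis m0 : forall j, (0 < m j)%N.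
Variable c : {ffun 'I_n.+1 -> nat} -> R[i].
Hypothesis fc : forall z, hartogs R n z ->
  ccvg (fun N => \sum_(a <- box n.+1 N) c a * hbasis m a z) (rkhs_fun f z).
Hypothesis nc : sqsum (box n.+1 N) c @[N --> \oo] --> rkhs_norm f ^+ 2.

Local Notation psum N := (fun z => \sum_(a <- box n.+1 N) c a * hbasis m a z).

Lemma hcoef_sqsum_le N : sqsum (box n.+1 N) c <= rkhs_norm f ^+ 2.
Proof.
apply: nondecreasing_seq_le_limit nc N.
by apply: sqsum_nondecreasing => *; [exact: box_uniq|exact: box_sub].
Qed.

Lemma hpsum_rotE t z N : psum N (trot t z) = \sum_(a <- box n.+1 N)
  (c a * hbasis m a z) * \prod_j cexp ((freq a j)%:~R * tnth t j).
Proof. by apply: eq_bigr => a _; rewrite hbasis_rot mulrA. Qed.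

Lemma cmeasurable_hpsum_rot D z N : cmeasurable D (fun t => psum N (trot t z)).
Proof.
under [X in cmeasurable _ X]eq_fun do rewrite hpsum_rotE.
apply: cmeasurable_sum => a.
exact: cmeasurableM (cmeasurable_cst _ _) (cmeasurable_character _ _).
Qed.

Lemma cmeasurable_rot D z : hartogs R n z -> cmeasurable D (fun t => rkhs_fun f (trot t z)).
Proof.
move=> Dz; apply: cmeasurable_cvg (cmeasurable_hpsum_rot D z) _ => t _.
by apply: fc; apply/hartogs_rot.
Qed.

(** Cauchy-Schwarz, with the moduli of the basis functions constant on the orbit. The bound depends
    neither on [t] nor on [N], as dominated convergence requires. *)
Lemma hpsum_rot_le z t N : hartogs R n z -> normc (psum N (trot t z)) ^+ 2 <=
  rkhs_norm f ^+ 2 * Re (hartogs_kernel m z z).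
Proof.
move=> Dz.
have e1 := hcoef_sqsum_le N.
have e2 : sqsum (box n.+1 N) (fun a => hbasis m a (trot t z)) <= Re (hartogs_kernel m z z).
  have -> : sqsum (box n.+1 N) (fun a => hbasis m a (trot t z)) =
            sqsum (box n.+1 N) (fun a => hbasis m a z).
    by apply: eq_bigr => a _; rewrite normc_hbasis_rot.
  apply: (@kernel_sqsum_le _ _ (hartogs R n) (hartogs_kernel m)) => //.
  - exact: box_uniq.
  - exact: box_sub.
  - exact: hartogs_kernel_expansion.
have e3 := normc_sum_le (box n.+1 N) c (fun a => hbasis m a (trot t z)).
apply: (@le_trans _ _ ((Num.sqrt (sqsum (box n.+1 N) c) *
    Num.sqrt (sqsum (box n.+1 N) (fun a => hbasis m a (trot t z)))) ^+ 2)).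
  by rewrite ler_pXn2r ?nnegrE ?normc_ge0 ?mulr_ge0 ?sqrtr_ge0.
by rewrite exprMn !(sqr_sqrtr (sqsum_ge0 _ _)) ler_pM ?sqsum_ge0.
Qed.

Lemma torus_mean_square_cvg z : hartogs R n z ->
  ((2 * pi) ^+ n.+1 * sqsum (box n.+1 N) (fun a => c a * hbasis m a z))%:E
    @[N --> \oo] -->
  (\int[lebesgue_Rn R n.+1]_(t in @cube R n.+1) (normc (rkhs_fun f (trot t z)) ^+ 2)%:E)%E.
Proof.
move=> Dz; pose M := rkhs_norm f ^+ 2 * Re (hartogs_kernel m z z).
have M0 : 0 <= M by exact: le_trans (sqr_ge0 _) (hpsum_rot_le [tuple of nseq _ 0] 0 Dz).
have mcube := @measurable_cube R n.+1.
have [] := @dominated_convergence _ _ _ (lebesgue_Rn R n.+1) (@cube R n.+1) mcube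
  (fun N t => (normc (psum N (trot t z)) ^+ 2)%:E)
  (fun t => (normc (rkhs_fun f (trot t z)) ^+ 2)%:E) (fun=> M%:E).
- by move=> N; apply/measurable_EFinP/measurable_normc2/cmeasurable_hpsum_rot.
- by apply/measurable_EFinP/measurable_normc2/cmeasurable_rot.
- apply: aeW => t _; apply: cvg_EFin; first by apply: nearW.
  by apply: ccvg_normc2; apply: fc; apply/hartogs_rot.
- apply/integrableP; split; first exact: measurable_cst.
  under eq_integral do rewrite gee0_abs ?lee_fin//.
  have := @integral_cube_cexp R n.+1 0 M (fun=> 0); rewrite Normc.normc0 => /(_ M0) h.
  rewrite (_ : (\int[_]_(x in _) _)%E = ((2 * pi) ^+ n.+1 * M)%:E) ?ltry//.
  move: h; rewrite mul0rn addr0 => <-.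
  by apply: eq_integral => t _; rewrite mul0r addr0.
- apply: aeW => t N _; rewrite gee0_abs ?lee_fin ?sqr_ge0//.
  exact: hpsum_rot_le.
move=> _ _; apply: cvg_trans; apply: near_eq_cvg; apply: nearW => N /=.
under eq_integral do rewrite hpsum_rotE.
rewrite torus_parseval//; first exact: box_uniq.
by move=> a b _ _ /freq_inj.
Qed.

End hartogs_expansion.

(** * The Hardy norm *)

Lemma cvg_prod_seq (R : realType) (I : Type) (r : seq I) (u : I -> nat -> R)
    (l : I -> R) : (forall i, u i k @[k --> \oo] --> l i) ->
  \prod_(i <- r) u i k @[k --> \oo] --> \prod_(i <- r) l i.
Proof.
move=> ul; elim: r => [|i r IH].
  by under eq_fun do rewrite big_nil; rewrite big_nil; exact: cvg_cst.
by under eq_fun do rewrite big_cons; rewrite big_cons; exact: cvgM.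
Qed.

Section hardy_norm.
Context {R : realType} (n : nat).
Implicit Types (t : 'I_n.+1 -> R) (a : {ffun 'I_n.+1 -> nat}).

(** The parametrisation for which the ratio of consecutive coordinates is exactly [t j], so that the
    [t j] range independently over the unit interval. *)
Definition radii t : 'rV[R[i]]_n.+1 :=
  \row_j (\prod_(k < n.+1 | (j <= k)%N) t k)%:C%C.

Lemma torus_pointE t theta : torus_point t theta = trot theta (radii t).
Proof.
apply/rowP => j; rewrite !mxE; apply: complex_eqP; rewrite ?cReM ?cImM/=.
  by rewrite mulr0 subr0 mulrC.
by rewrite mulr0 add0r mulrC.
Qed.

Lemma hcoord_radii t (j : nat) :
  hcoord (radii t) j = (\prod_(k < n.+1 | (j <= k)%N) t k)%:C%C.
Proof.
rewrite /hcoord; case: insubP => [i _ <-|]; first by rewrite /oapp mxE.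
rewrite -leqNgt => nj; rewrite /oapp big_pred0// => k.
by apply/negbTE; rewrite -ltnNge (leq_trans (ltn_ord k)).
Qed.

Lemma hcoord_radiiS t (j : 'I_n.+1) :
  hcoord (radii t) j = (t j)%:C%C * hcoord (radii t) j.+1.
Proof.
rewrite !hcoord_radii -rmorphM/= (bigD1 j)//=; congr (_ * _)%:C%C.
by apply: eq_bigl => k; rewrite ltn_neqAle eq_sym andbC.
Qed.

Lemma hcoord_radii_gt0 t (j : nat) : (forall k, 0 < t k) -> 0 < normc (hcoord (radii t) j).
Proof.
move=> t0; rewrite hcoord_radii normc_real normr_gt0 gt_eqF//.
by apply: prodr_gt0 => k _.
Qed.

Lemma radii_hartogs t : (forall j, 0 < t j < 1) -> hartogs R n (radii t).
Proof.
move=> t01; apply/hartogsP => j; rewrite hcoord_radiiS Normc.normcM normc_real.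
have t0 k : 0 < t k by case/andP: (t01 k).
have /andP[tj0 tj1] := t01 j.
by rewrite gtr0_norm// -[ltRHS]mul1r ltr_pM2r// hcoord_radii_gt0.
Qed.

Lemma hratio_radii t j : (forall k, 0 < t k) -> hratio (radii t) j = (t j)%:C%C.
Proof.
move=> t0; rewrite /hratio -hcoord_ord hcoord_radiiS mulfK//.
by rewrite -normc_gt0 hcoord_radii_gt0.
Qed.

(** [t j] is a factor of the coordinate [k + 1] exactly when [k < j], that is, for [j] values of
    [k]. *)
Lemma prod_radii t : \prod_(k < n) normc (cr (radii t) k) =
  \prod_(j < n.+1) `|t j| ^+ j.
Proof.
under eq_bigr do rewrite -hcoordS hcoord_radii normc_real normr_prod.
rewrite (exchange_big_dep xpredT)//=; apply: eq_bigr => j _.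
rewrite -(big_ord_widen_cond n predT (fun=> `|t j|)) ?prodr_const ?card_ord//.
by rewrite -ltnS ltn_ord.
Qed.

(** The prefactor of the monomial contributes [t j] to the power -2j, which the weight 2j + 1
    compensates; one positive power is left over and tends to 1 with [t j]. *)
Lemma torus_weight_monom t a : (forall j, 0 < t j) ->
  (\prod_(j < n.+1) t j ^+ (j.*2.+1)) * normc (monom a (radii t)) ^+ 2 =
  \prod_j t j ^+ (a j).*2.+1.
Proof.
move=> t0; rewrite /monom Normc.normcM Normc.normcV exprMn exprVn.
rewrite !normc_prod prod_radii -!prodrXl -prodfV -!big_split/=.
apply: eq_bigr => j _; rewrite hratio_radii// normcX normc_real.
rewrite gtr0_norm// -!exprM !muln2 [in LHS]exprS [in RHS]exprS mulrA mulfK//.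
by rewrite expf_neq0// gt_eqF.
Qed.

Lemma coefc1 a : coefc (fun=> 1%N) a = 1 :> R.
Proof. by rewrite /coefc big1// => j _; rewrite bin0. Qed.

Theorem hardy_norm_torus (H : hartogs_space R n (fun=> 1%N)) (f : H) :
  (rkhs_norm f ^+ 2)%:E =
  ereal_sup [set torus_mean (rkhs_fun f) t | t in [set t | forall j, 0 < t j < 1]].
Proof.
have [c [fc nc]] := rkhs_expansion (@box_uniq n.+1) (@box_sub n.+1)
  (hartogs_kernel_expansion (fun=> ltn0Sn 0)) f.
pose sq N t := \sum_(a <- box n.+1 N) normc (c a) ^+ 2 * \prod_j t j ^+ (a j).*2.+1.
have pi0 : (2 * pi) ^+ n.+1 != 0 :> R by rewrite expf_neq0// mulf_neq0 ?gt_eqF ?pi_gt0.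
have mean_cvg t : (forall j, 0 < t j < 1) ->
    (sq N t)%:E @[N --> \oo] --> torus_mean (rkhs_fun f) t.
  move=> t01; have t0 k : 0 < t k by case/andP: (t01 k).
  have Dt := radii_hartogs t01.
  have w0 : 0 <= (\prod_(j < n.+1) t j ^+ (j.*2.+1)) / (2 * pi) ^+ n.+1.
    rewrite divr_ge0//; first by apply: prodr_ge0 => j _; rewrite exprn_ge0// ltW.
    by rewrite exprn_ge0// mulr_ge0// pi_ge0.
  have -> : torus_mean (rkhs_fun f) t =
    (((\prod_(j < n.+1) t j ^+ (j.*2.+1)) / (2 * pi) ^+ n.+1)%:E *
     \int[lebesgue_Rn R n.+1]_(u in @cube R n.+1)
        (normc (rkhs_fun f (trot u (radii t))) ^+ 2)%:E)%E.
    rewrite -ge0_integralZl//.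
    - by apply: eq_integral => u _; rewrite -EFinM torus_pointE [in RHS]mulrC mulrA.
    - exact: measurable_cube.
    - exact/measurable_EFinP/measurable_normc2/(cmeasurable_rot fc).
    - by move=> u _; rewrite lee_fin sqr_ge0.
  have := torus_mean_square_cvg (fun=> ltn0Sn 0) fc nc Dt.
  move=> /(cvgeZl (_ : _ \is a fin_num)).
  move=> /(_ ((\prod_(j < n.+1) t j ^+ (j.*2.+1)) / (2 * pi) ^+ n.+1)%:E isT).
  apply: cvg_trans; apply: near_eq_cvg; apply: nearW => N.
  rewrite -EFinM mulrA mulfVK// /sq /sqsum mulr_sumr; congr _%:E.
  apply: eq_bigr => a _; rewrite -torus_weight_monom// /hbasis coefc1 sqrtr1 rmorph1 mul1r.
  by rewrite Normc.normcM exprMn mulrCA.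
apply/eqP; rewrite eq_le; apply/andP; split; last first.
  (* Upper bound: the powers of the [t j] are at most 1, so each mean is bounded by the full sum of
     squared coefficients. *)
  apply: ge_ereal_sup => _ [t /= t01 <-].
  rewrite -(cvg_lim _ (mean_cvg t t01))//; apply: lime_le.
    by apply/cvg_ex; eexists; exact: mean_cvg.
  apply: nearW => N; rewrite lee_fin; apply: le_trans (hcoef_sqsum_le nc N).
  apply: ler_sum => a _; rewrite -[leRHS]mulr1 ler_wpM2l ?sqr_ge0//.
  apply: prodr_ile1 => j _; have /andP[t0 t1] := t01 j.
  by apply/andP; split; [exact: exprn_ge0 (ltW t0)|exact: exprn_ile1 (ltW t0) (ltW t1)].
pose S := [set torus_mean (rkhs_fun f) t | t in [set t : 'I_n.+1 -> R | forall j, 0 < t j < 1]].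
(* Lower bound: with [N] fixed, all radii tend to 1 together in a finite sum, which each mean
   dominates. *)
rewrite -/S; have step N : ((sqsum (box n.+1 N) c)%:E <= ereal_sup S)%E.
  (* The shift by 2 keeps [u 0] positive. *)
  pose u (k : nat) : R := 1 - k.+2%:R^-1.
  have u01 k : 0 < u k < 1.
    by rewrite /u gtrBl invr_gt0 ltr0n andbT subr_gt0 invf_lt1 ?ltr1n.
  have u1 : u k @[k --> \oo] --> (1 : R).
    rewrite -[X in _ --> X]subr0; apply: cvgB; first exact: cvg_cst.
    by have := @cvg_invS R; rewrite -(cvg_shiftS (fun k => k.+1%:R^-1 : R)).
  have squ : (sq N (fun=> u k))%:E @[k --> \oo] --> (sqsum (box n.+1 N) c)%:E.
    apply: cvg_EFin; first by apply: nearW.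
    apply: cvg_sum_seq => a _; rewrite -[X in _ --> X]mulr1; apply: cvgMr.
    rewrite -[X in _ --> X](_ : \prod_(j < n.+1) 1 ^+ (a j).*2.+1 = 1); last first.
      by rewrite big1// => j _; rewrite expr1n.
    apply: cvg_prod_seq => j; rewrite expr1n -[X in _ --> X](expr1n _ (a j).*2.+1).
    exact: cvg_comp u1 (@exprn_continuous _ _ _).
  rewrite -(cvg_lim _ squ)//; apply: lime_le.
    by apply/cvg_ex; eexists; exact: squ.
  apply: nearW => k; apply: (@le_trans _ _ (torus_mean (rkhs_fun f) (fun=> u k))).
    rewrite -(cvg_lim _ (mean_cvg _ (fun=> u01 k)))//; apply: lime_ge.
      by apply/cvg_ex; eexists; exact: mean_cvg.
    exists N => // M NM; rewrite lee_fin; apply: ler_sum_subset.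
    - exact: box_uniq.
    - exact: box_uniq.
    - exact: box_sub.
    move=> a; rewrite mulr_ge0 ?sqr_ge0//; apply: prodr_ge0 => j _.
    by rewrite exprn_ge0// ltW//; case/andP: (u01 k).
  by apply: ereal_sup_ubound; exists (fun=> u k).
have ncE : (sqsum (box n.+1 N) c)%:E @[N --> \oo] --> (rkhs_norm f ^+ 2)%:E.
  by apply: cvg_EFin => //; apply: nearW.
rewrite -(cvg_lim _ ncE)//; apply: lime_le; last by apply: nearW => N; exact: step.
by apply/cvg_ex; eexists; exact: ncE.
Qed.

End hardy_norm.

(** * Rotations and radial functions in the plane *)

Section plane_lebesgue.
Context {R : realType}.
Local Notation mu := (@lebesgue_measure R).
Local Notation MR := (measurableTypeR R).
Local Notation mu2 := (sf_product mu mu).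
Implicit Types (F : MR * MR -> \bar R).

Lemma ge0_integral_translation (g : MR -> \bar R) (s : R) :
  measurable_fun setT g -> (forall x, (0 <= g x)%E) ->
  (\int[mu]_x g ((x : R) + s)%R = \int[mu]_x g x)%E.
Proof.
move=> mg g0; pose phi (x : MR) : MR := (x : R) + s.
have mphi : measurable_fun setT phi by apply: measurable_funD => //; exact: measurable_cst.
transitivity (\int[pushforward mu phi]_x g x)%E.
  by rewrite ge0_integral_pushforward// preimage_setT.
apply: eq_measure_integral => A mA _; apply/esym.
apply: (lebesgue_measure_unique (mu := pushforward mu phi)) => // _ [[a b] _ <-].
transitivity (mu [set` `]a - s, b - s]]).
  rewrite !lebesgue_measure_itv/= !lte_fin ltrD2r; case: ifP => // _.
  by rewrite -!EFinD; congr _%:E; lra.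
congr (mu _); apply/seteqP; split => x /=;
  by rewrite !in_itv/= /phi ltrBlDr lerBrDr.
Qed.

Definition mu2_invariant (phi : MR * MR -> MR * MR) :=
  measurable_fun setT phi /\
  forall F, measurable_fun setT F -> (forall x, (0 <= F x)%E) ->
    (\int[mu2]_x F (phi x) = \int[mu2]_x F x)%E.

Lemma mu2_invariant_comp phi psi : mu2_invariant phi -> mu2_invariant psi ->
  mu2_invariant (phi \o psi).
Proof.
move=> [mphi iphi] [mpsi ipsi]; split; first exact: measurableT_comp.
move=> F mF F0; rewrite -(iphi F mF F0).
by rewrite -(ipsi _ (measurableT_comp mF mphi) (fun x => F0 (phi x))).
Qed.

(** With the second coordinate fixed, a shear is a translation of the line; Tonelli does the
    rest. *)
Lemma shear_fst (s : R) : mu2_invariant (fun x => ((x.1 : R) + s * (x.2 : R), x.2) : MR * MR).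
Proof.
have mphi : measurable_fun setT (fun x : MR * MR => ((x.1 : R) + s * (x.2 : R), x.2) : MR * MR).
  apply: measurable_fun_pair => //=.
  by apply: measurable_funD => //; apply: measurable_funM => //; exact: measurable_cst.
split=> // F mF F0; have mFphi := measurableT_comp mF mphi.
rewrite /sf_product (@fubini_tonelli2 _ _ _ _ R mu mu _ mFphi (fun x => F0 _)).
rewrite (@fubini_tonelli2 _ _ _ _ R mu mu _ mF F0); apply: eq_integral => y _.
rewrite /fubini_G/=.
apply: (ge0_integral_translation (g := fun x => F (x, y))) => [|x]; last exact: F0.
exact: measurableT_comp mF (pair2_measurable _).
Qed.

Lemma shear_snd (s : R) : mu2_invariant (fun x => (x.1, (x.2 : R) + s * (x.1 : R)) : MR * MR).
Proof.
have mphi : measurable_fun setT (fun x : MR * MR => (x.1, (x.2 : R) + s * (x.1 : R)) : MR * MR).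
  apply: measurable_fun_pair => //=.
  by apply: measurable_funD => //; apply: measurable_funM => //; exact: measurable_cst.
split=> // F mF F0; have mFphi := measurableT_comp mF mphi.
rewrite /sf_product (@fubini_tonelli1 _ _ _ _ R mu mu _ mFphi (fun x => F0 _)).
rewrite (@fubini_tonelli1 _ _ _ _ R mu mu _ mF F0); apply: eq_integral => y _.
rewrite /fubini_F/=.
apply: (ge0_integral_translation (g := fun x => F (y, x))) => [|x]; last exact: F0.
exact: measurableT_comp mF (pair1_measurable _).
Qed.

Definition plane_rotation (c s : R) (x : MR * MR) : MR * MR :=
  (c * (x.1 : R) - s * (x.2 : R), s * (x.1 : R) + c * (x.2 : R)).

(* A rotation by an angle other than pi is a product of three shears. *)
Lemma plane_rotation_invariant_neqN1 (c s : R) : c ^+ 2 + s ^+ 2 = 1 -> c != -1 ->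
  mu2_invariant (plane_rotation c s).
Proof.
move=> cs cN1; have c1 : 1 + c != 0 by rewrite addrC -(opprK 1) subr_eq0.
(* For [c = cos x] and [s = sin x] this is minus the tangent of [x / 2], the coefficient of the two
   outer shears. *)
pose e := - s / (1 + c).
have s2 : s ^+ 2 = (1 - c) * (1 + c) by rewrite -[s ^+ 2](addKr (c ^+ 2)) cs; ring.
have sE : s * e = c - 1.
  by rewrite /e mulrA mulrN -expr2 s2 -mulNr mulfK//; ring.
have eE : e * (1 + c) = - s by rewrite /e mulfVK.
have key2 (a b : R) : b + s * (a + e * b) = s * a + c * b.
  by transitivity (b + s * a + s * e * b); [ring|rewrite sE; ring].
have key1 (a b : R) : a + e * b + e * (b + s * (a + e * b)) = c * a - s * b.
  rewrite key2; transitivity (a + (s * e) * a + e * (1 + c) * b); first ring.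
  by rewrite sE eE; ring.
have := mu2_invariant_comp (shear_fst e) (mu2_invariant_comp (shear_snd s) (shear_fst e)).
congr mu2_invariant; apply/funext => -[a b]; rewrite /plane_rotation/=.
by congr (_, _); [exact: key1|exact: key2].
Qed.

(** The excluded half-turn is the square of a quarter-turn. *)
Lemma plane_rotation_invariant (c s : R) : c ^+ 2 + s ^+ 2 = 1 ->
  mu2_invariant (plane_rotation c s).
Proof.
move=> cs; have [cN1|cN1] := eqVneq c (-1); last exact: plane_rotation_invariant_neqN1.
have s0 : s = 0.
  by move: cs; rewrite cN1 sqrrN expr1n => /(canRL (addKr _)); rewrite addNr => /eqP;
    rewrite sqrf_eq0 => /eqP.
have N1 : (0 : R) != -1 by rewrite eq_sym oppr_eq0 oner_eq0.
have i1 : mu2_invariant (plane_rotation 0 1).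
  by apply: plane_rotation_invariant_neqN1 => //; rewrite expr0n expr1n add0r.
have := mu2_invariant_comp i1 i1; congr mu2_invariant; apply/funext => -[a b].
by rewrite /plane_rotation/= cN1 s0; congr (_, _); ring.
Qed.

(** The square root of a negative number is 0, so the formula also covers empty sections. *)
Lemma disc_section_area (r a : R) :
  mu [set b | a ^+ 2 + (b : R) ^+ 2 <= r] = (2 * Num.sqrt (r - a ^+ 2))%:E.
Proof.
have [ra|ra] := leP (a ^+ 2) r; last first.
  rewrite ler0_sqrtr ?subr_le0 1?ltW// mulr0 (_ : [set _ | _] = set0) ?measure0//.
  apply/seteqP; split => // b /=; apply/negP; rewrite -ltNge.
  by rewrite (lt_le_trans ra)// lerDl sqr_ge0.
have ra0 : 0 <= r - a ^+ 2 by rewrite subr_ge0.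
transitivity (mu [set` `[- Num.sqrt (r - a ^+ 2), Num.sqrt (r - a ^+ 2)]]).
  congr (mu _); apply/seteqP; split => b /=; rewrite in_itv/= -ler_norml -lerBrDl.
    by move=> h; rewrite -sqrtr_sqr ler_wsqrtr.
  by rewrite -sqrtr_sqr ler_sqrt.
rewrite lebesgue_measure_itv/= lte_fin; have s0 := sqrtr_ge0 (r - a ^+ 2).
have [s1|s1] := ltP; first by rewrite -EFinB; congr _%:E; ring.
congr _%:E; lra.
Qed.

(** Substitution of [r * sin x], after which [P] is an explicit primitive. *)
Lemma half_disc_integral (r : R) : 0 <= r ->
  (\int[mu]_(a in [set` `[(- r)%R, r]]) (2 * Num.sqrt (r ^+ 2 - (a : R) ^+ 2))%:E =
   (pi * r ^+ 2)%:E)%E.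
Proof.
rewrite le_eqVlt => /predU1P[<-|r0].
  rewrite oppr0 expr0n/= mulr0 integral0_eq// => a /=; rewrite in_itv/= => /andP[a0 a1].
  by rewrite (@le_anti _ _ a 0) ?a0 ?a1// expr0n/= subr0 sqrtr0 mulr0.
have pi20 : - (pi / 2) < pi / 2 :> R.
  by rewrite -subr_gt0 opprK addr_gt0// divr_gt0// pi_gt0.
pose F (x : R) : R := r * sin x.
have dF (x : R) : is_derive x 1 F (r * cos x) by apply: is_derive_eq.
have F'E : F^`()%classic = (fun x : R => r * cos x).
  by apply/funext => x; rewrite derive1E; apply: derive_val.
have cF : continuous F.
  by move=> x; apply/differentiable_continuous/derivable1_diffP/ex_derive.
have cF' : continuous (fun x : R => r * cos x).
  by move=> x; apply: cvgMr; exact: continuous_cos.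
pose G (a : R) : R := 2 * Num.sqrt (r ^+ 2 - a ^+ 2).
have cG : continuous G.
  move=> x; apply: cvgMr.
  apply: (@continuous_comp _ _ _ (fun a : R => r ^+ 2 - a ^+ 2) Num.sqrt).
    by apply: cvgB; [exact: cvg_cst|exact: exprn_continuous].
  exact: sqrt_continuous.
have [Fl Fr] : F (- (pi / 2)) = - r /\ F (pi / 2) = r.
  by rewrite /F sinN sin_pihalf mulrN1 mulr1.
rewrite -[in X in `[X, _]]Fl -[in X in `[_, X]]Fr.
rewrite (@integration_by_substitution_increasing _ F G) ?ltW//; first last.
- exact: continuous_subspaceT.
- split; first by move=> x _; apply: ex_derive.
  + by apply: cvg_at_right_filter; exact: cF.
  + by apply: cvg_at_left_filter; exact: cF.
- by rewrite F'E; apply/cvg_ex; eexists; apply: cvg_at_left_filter; exact: cF'.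
- by rewrite F'E; apply/cvg_ex; eexists; apply: cvg_at_right_filter; exact: cF'.
- by rewrite F'E => x _; exact: cF'.
- by move=> x y xl yl xy; rewrite /F ltr_pM2l// ltr_sin.
pose P (x : R) : R := r ^+ 2 * (x + sin x * cos x).
have dP (x : R) : is_derive x 1 P (2 * r ^+ 2 * cos x ^+ 2).
  apply: is_derive_eq; rewrite /GRing.scale/=.
  have := cos2Dsin2 x => /(canRL (addKr _)) s2.
  transitivity (r ^+ 2 * (1 + cos x ^+ 2 - sin x ^+ 2)); first ring.
  by rewrite s2; ring.
have cP : continuous P.
  by move=> x; apply/differentiable_continuous/derivable1_diffP/ex_derive.
transitivity (\int[mu]_(x in [set` `[(- (pi / 2))%R, (pi / 2)%R]]) (2 * r ^+ 2 * cos x ^+ 2)%:E)%E.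
  apply: eq_integral => x /set_mem/=; rewrite in_itv/= => /cos_ge0_pihalf c0.
  rewrite F'E; congr _%:E.
  transitivity (2 * Num.sqrt (r ^+ 2 - (r * sin x) ^+ 2) * (r * cos x)) => //.
  have -> : r ^+ 2 - (r * sin x) ^+ 2 = (r * cos x) ^+ 2.
    by rewrite exprMn sin2cos2; ring.
  by rewrite sqrtr_sqr ger0_norm ?mulr_ge0 ?(ltW r0)//; ring.
rewrite (@continuous_FTC2 _ _ P)//.
- rewrite -EFinB /P cosN sinN cos_pihalf !mulr0 !addr0; congr _%:E.
  by rewrite [in RHS](splitr pi); ring.
- apply: continuous_subspaceT => x; apply: cvgMr.
  apply: (@continuous_comp _ _ _ cos (fun y : R => y ^+ 2)); first exact: continuous_cos.
  exact: exprn_continuous.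
- split; first by move=> x _; apply: ex_derive.
  + by apply: cvg_at_right_filter; exact: cP.
  + by apply: cvg_at_left_filter; exact: cP.
- by move=> x _; rewrite derive1E; apply: derive_val.
Qed.

Lemma measurable_sqnorm (D : set (MR * MR)) :
  measurable_fun D (fun x : MR * MR => (x.1 : R) ^+ 2 + (x.2 : R) ^+ 2 : MR).
Proof. by apply: measurable_funD; apply: measurable_funX; apply: measurable_funTS. Qed.

Lemma disc_area (r : R) : mu2 [set x | (x.1 : R) ^+ 2 + (x.2 : R) ^+ 2 <= r] =
  (pi * Num.max 0 r)%:E.
Proof.
pose A := [set x : MR * MR | (x.1 : R) ^+ 2 + (x.2 : R) ^+ 2 <= r].
have -> : mu2 A = (\int[mu]_a (2 * Num.sqrt (r - (a : R) ^+ 2))%:E)%E.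
  by apply: eq_integral => a _; rewrite -disc_section_area/= xsectionE.
have [r0|r0] := leP 0 r; last first.
  rewrite mulr0 integral0_eq// => a _; rewrite ler0_sqrtr ?mulr0//.
  by rewrite subr_le0 (le_trans (ltW r0))// sqr_ge0.
rewrite -[in RHS](sqr_sqrtr r0) -half_disc_integral ?sqrtr_ge0// [RHS]integral_mkcond.
apply: eq_integral => a _; rewrite patchE; case: ifPn => [_|]; rewrite ?sqr_sqrtr//.
rewrite notin_setE/= in_itv/= -ler_norml => /negP; rewrite -ltNge => ra.
rewrite ler0_sqrtr ?mulr0// subr_le0 -(sqr_sqrtr r0) -[leRHS]real_normK ?num_real//.
by rewrite ler_pXn2r ?nnegrE ?sqrtr_ge0// ltW.
Qed.

End plane_lebesgue.

Section radial.
Context {R : realType}.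
Local Notation mu := (@lebesgue_measure R).
Local Notation MR := (measurableTypeR R).
Local Notation mu2 := (sf_product mu mu).

Lemma measurable_disc (r : R) :
  measurable [set x : MR * MR | (x.1 : R) ^+ 2 + (x.2 : R) ^+ 2 <= r].
Proof.
have := measurable_sqnorm measurableT (measurable_itv `]-oo, r]).
by rewrite setTI; congr measurable; apply/seteqP; split => x /=; rewrite in_itv.
Qed.

Lemma annulus_area (r s : R) : r <= s ->
  mu2 [set x | r < (x.1 : R) ^+ 2 + (x.2 : R) ^+ 2 <= s] =
  (pi * (Num.max 0 s - Num.max 0 r))%:E.
Proof.
move=> rs; pose A (r : R) := [set x : MR * MR | (x.1 : R) ^+ 2 + (x.2 : R) ^+ 2 <= r].
have -> : [set x : MR * MR | r < (x.1 : R) ^+ 2 + (x.2 : R) ^+ 2 <= s] = A s `\` A r.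
  apply/seteqP; split => x /=.
    by move=> /andP[h1 h2]; split => //; apply/negP; rewrite -ltNge.
  by move=> [h1 /negP]; rewrite -ltNge => -> /=.
have mA := measurable_disc.
have AE : A s `&` A r = A r.
  apply/seteqP; split => x /=; first by move=> [].
  by move=> xr; split => //; exact: le_trans rs.
have aE t : mu2 (A t) = (pi * Num.max 0 t)%:E := disc_area t.
transitivity (mu2 (A s) - mu2 (A s `&` A r))%E; last by rewrite AE !aE mulrBr.
apply: measureD; [exact: mA|exact: mA|].
by apply: le_lt_trans (ltry (pi * Num.max 0 s)); rewrite -aE.
Qed.

(** The image of the area measure under [rho] is [pi * q] times Lebesgue measure on the half-line,
    since annulus areas give its values on half-open intervals. The scale [q] will be the squared
    modulus of the next coordinate. *)
Lemma ge0_integral_radial (q : R) (h : MR -> \bar R) : 0 < q ->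
  measurable_fun setT h -> (forall x, (0 <= h x)%E) ->
  (\int[mu2]_x h (((x.1 : R) ^+ 2 + (x.2 : R) ^+ 2) / q)%R =
   (pi * q)%:E * \int[mu]_(s in [set` `[0%R, +oo[]) h s)%E.
Proof.
move=> q0 mh h0; have piq0 : 0 < pi * q by rewrite mulr_gt0// pi_gt0.
pose rho (x : MR * MR) : MR := ((x.1 : R) ^+ 2 + (x.2 : R) ^+ 2) / q.
have mrho : measurable_fun setT rho.
  by apply: measurable_funM; [exact: measurable_sqnorm|exact: measurable_cst].
pose k : {nonneg R} := NngNum (ltW (eqbRL (invr_gt0 _) piq0)).
have mneg : measurable (`]-oo, 0[%classic : set MR) by exact: measurable_itv.
pose nu : {measure set MR -> \bar R} :=
  measure_function_pushforward__canonical__measure_function_Measure mu2 mrho.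
(* The uniqueness lemma is about Lebesgue measure on the whole line, hence the
   added restriction of [mu] to the negative half-line. *)
pose m := measure_add (mscale k nu) (mrestr mu mneg).
have muE (A : set MR) : measurable A -> mu A = m A.
  move=> mA; apply: lebesgue_measure_unique mA => _ [[a b] _ <-].
  transitivity ((k%:num)%:E * nu `]a, b]%classic +
      mu (`]a, b]%classic `&` `]-oo, 0%R[%classic))%E; last first.
    by symmetry; exact: measure_addE.
  have [ab|ba] := ltP a b; last first.
    have E0 : `]a, b]%classic = set0 :> set R by rewrite set_itv_ge// bnd_simp -leNgt.
    by rewrite E0 set0I !measure0 mule0 addr0.
  have -> : nu `]a, b]%classic =
      (pi * q * (Num.max 0 b - Num.max 0 a))%:E.
    transitivity (mu2 [set x | a * q < (x.1 : R) ^+ 2 + (x.2 : R) ^+ 2 <= b * q]).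
      congr (mu2 _); apply/seteqP; split => x /=;
        by rewrite in_itv/= /rho ltr_pdivlMr// ler_pdivrMr.
    rewrite annulus_area ?ler_pM2r// ?(ltW ab)// -mulrA; congr (_ * _)%:E.
    have maxM x : Num.max 0 (x * q) = q * Num.max 0 x.
      by rewrite [RHS]mulrC maxr_pMl ?(ltW q0)// mul0r.
    by rewrite !maxM mulrBr.
  rewrite -EFinM mulrA mulVf ?gt_eqF// mul1r.
  have [b0|b0] := ltP b 0.
    rewrite (_ : _ `&` _ = `]a, b]%classic); last first.
      apply/seteqP; split => x /=; first by move=> [].
      by move=> xab; split => //; move: xab; rewrite !in_itv/= => /andP[_ /le_lt_trans]; exact.
    by rewrite !max_l ?(ltW b0)// ?(ltW (lt_trans ab b0))// subrr add0e.
  rewrite (_ : _ `&` _ = `]a, 0[%classic); last first.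
    apply/seteqP; split => x /=; rewrite !in_itv/=.
      by move=> [/andP[-> _] ->].
    by move=> /andP[-> x0]; rewrite x0 (ltW (lt_le_trans x0 b0)).
  rewrite !lebesgue_measure_itv/= !lte_fin ab.
  have [a0|a0] := ltP a 0; first by rewrite -!EFinD; congr _%:E; ring.
  by rewrite adde0.
have piqV : (k%:num)%:E = ((pi * q)^-1)%:E by [].
rewrite (eq_measure_integral m); last by move=> A mA _; exact: muE.
rewrite /m ge0_integral_measure_add//=; [|exact: measurable_funTS].
rewrite ge0_integral_mscale//=; [|exact: measurable_funTS].
rewrite (_ : (\int[mrestr _ _]_(x in _) _)%E = 0%E); last first.
  apply: null_set_integral => //; first exact: measurable_funTS.
  transitivity (mu (`[0%R, +oo[%classic `&` `]-oo, 0%R[%classic)) => //.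
  rewrite (_ : _ `&` _ = set0) ?measure0//.
  by apply/seteqP; split => x //=; rewrite !in_itv/= andbT => -[]; rewrite leNgt => /negP.
rewrite adde0 muleA -EFinM mulfV ?gt_eqF// mul1e ge0_integral_pushforward//; last first.
  exact: measurable_funTS.
rewrite (_ : rho @^-1` _ = setT)//; apply/seteqP; split => // x _ /=.
by rewrite in_itv/= andbT /rho divr_ge0 ?(ltW q0)// addr_ge0 ?sqr_ge0.
Qed.

End radial.

(** * Circle averages and radial products on C^n *)

Section tuple_rotation.
Context {R : realType}.
Local Notation mu := (@lebesgue_measure R).
Local Notation MR := (measurableTypeR R).
Local Notation mu2 := (sf_product mu mu).

Definition rotp n (th : 'I_n -> R) (p : n.-tuple (MR * MR)) : n.-tuple (MR * MR) :=
  [tuple plane_rotation (cos (th j)) (sin (th j)) (tnth p j) | j < n].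

Lemma rotp_tcons n (th : 'I_n.+1 -> R) x (t : n.-tuple (MR * MR)) :
  rotp th (tcons (x, t)) =
  tcons (plane_rotation (cos (th ord0)) (sin (th ord0)) x, rotp (th \o lift ord0) t).
Proof.
apply: eq_from_tnth => j; rewrite tnth_mktuple.
by case: (unliftP ord0 j) => [k|] ->; rewrite ?tnthS// tnth_mktuple.
Qed.

Lemma cos_sin_invariant (x : R) : mu2_invariant (plane_rotation (cos x) (sin x)).
Proof. exact/plane_rotation_invariant/cos2Dsin2. Qed.

Lemma measurable_rotp n (th : 'I_n -> R) : measurable_fun setT (rotp th).
Proof.
apply/measurable_fun_tnthP => j.
rewrite (_ : _ \o _ = plane_rotation (cos (th j)) (sin (th j)) \o (fun p => tnth p j)).
  by apply: measurableT_comp (measurable_tnth j); have [] := cos_sin_invariant (th j).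
by apply/funext => p /=; rewrite tnth_mktuple.
Qed.

Lemma tuple0_eq (T : Type) (t u : 0.-tuple T) : t = u.
Proof. by rewrite (tuple0 t) (tuple0 u). Qed.

Lemma integral_rotp n (th : 'I_n -> R) (G : n.-tuple (MR * MR) -> \bar R) :
  measurable_fun setT G -> (forall p, (0 <= G p)%E) ->
  (\int[lebesgue_Cn R n]_p G (rotp th p) = \int[lebesgue_Cn R n]_p G p)%E.
Proof.
elim: n th G => [|n IH] th G mG G0.
  by apply: eq_integral => p _; congr G; exact: tuple0_eq.
have mGr := measurableT_comp mG (measurable_rotp th).
rewrite (integral_tuple_measure_head_tail mu2 mGr (fun p => G0 (rotp th p))).
rewrite (integral_tuple_measure_head_tail mu2 mG G0).
have mGt := measurable_integral_tail mu2 mG G0.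
have mGt0 x : (0 <= \int[lebesgue_Cn R n]_t G (tcons (x, t)))%E by exact: integral_ge0.
apply: etrans ((cos_sin_invariant (th ord0)).2 _ mGt mGt0).
apply: eq_integral => x _; pose y := plane_rotation (cos (th ord0)) (sin (th ord0)) x.
transitivity (\int[lebesgue_Cn R n]_t G (tcons (y, rotp (th \o lift ord0) t)))%E.
  apply: eq_integral => t _.
  by congr G; exact: rotp_tcons.
apply: (IH (th \o lift ord0) (fun t => G (tcons (y, t)))) => [|t]; last exact: G0.
apply: measurableT_comp mG _.
exact: measurableT_comp (@measurable_tcons _ _ n) (pair1_measurable _).
Qed.

Lemma measurable_rotp_joint n : measurable_fun setT
  (fun x : n.-tuple MR * n.-tuple (MR * MR) => rotp (fun j => tnth x.1 j) x.2).
Proof.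
apply/measurable_fun_tnthP => j.
rewrite (_ : _ \o _ = (fun x : n.-tuple MR * n.-tuple (MR * MR) =>
  plane_rotation (cos (tnth x.1 j)) (sin (tnth x.1 j)) (tnth x.2 j))); last first.
  by apply/funext => x /=; rewrite tnth_mktuple.
have m1 : measurable_fun setT (fun x : n.-tuple MR * n.-tuple (MR * MR) => tnth x.1 j).
  exact: measurableT_comp (measurable_tnth j) measurable_fst.
have m2 : measurable_fun setT (fun x : n.-tuple MR * n.-tuple (MR * MR) => tnth x.2 j).
  exact: measurableT_comp (measurable_tnth j) measurable_snd.
have mc := measurableT_comp (continuous_measurable_fun (@continuous_cos R)) m1.
have ms := measurableT_comp (continuous_measurable_fun (@continuous_sin R)) m1.
have m21 := measurableT_comp measurable_fst m2.
have m22 := measurableT_comp measurable_snd m2.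
apply: measurable_fun_pair.
  by apply: measurable_funB; apply: measurable_funM.
by apply: measurable_funD; apply: measurable_funM.
Qed.

(** For each fixed tuple of angles the integral of [G] is unchanged; integrating over the angle
    cube, of volume (2 pi)^n, and exchanging the order gives the average. *)
Lemma integral_circle_average n (G : n.-tuple (MR * MR) -> \bar R) :
  measurable_fun setT G -> (forall p, (0 <= G p)%E) ->
  (((2 * pi) ^+ n)%:E * \int[lebesgue_Cn R n]_p G p =
   \int[lebesgue_Cn R n]_p \int[lebesgue_Rn R n]_(t in @cube R n) G (rotp (tnth t) p))%E.
Proof.
move=> mG G0; pose f (x : n.-tuple MR * n.-tuple (MR * MR)) : \bar R :=
  (G (rotp (tnth x.1) x.2) * (\1_(@cube R n) x.1)%:E)%E.
have mf : measurable_fun setT f.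
  apply: emeasurable_funM; first exact: measurableT_comp mG (@measurable_rotp_joint n).
  apply/measurable_EFinP; apply: measurableT_comp measurable_fst.
  apply: measurable_indic; exact: (@measurable_cube R n).
have f0 x : (0 <= f x)%E by rewrite mule_ge0// lee_fin.
have := @fubini_tonelli _ _ _ _ R (lebesgue_Rn R n) (lebesgue_Cn R n) _ mf f0.
rewrite /f/= => E.
transitivity (\int[lebesgue_Rn R n]_t \int[lebesgue_Cn R n]_p
    (G (rotp (tnth t) p) * (\1_(@cube R n) t)%:E))%E.
  transitivity (\int[lebesgue_Rn R n]_t
      ((\int[lebesgue_Cn R n]_p G p) * (\1_(@cube R n) t)%:E))%E; last first.
    apply: eq_integral => t _; rewrite ge0_integralZr//.
      by rewrite integral_rotp.
    exact: measurableT_comp mG (measurable_rotp _).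
  rewrite ge0_integralZl//; last 2 first.
  - apply/measurable_EFinP; apply: measurable_indic; exact: (@measurable_cube R n).
  - by apply: integral_ge0.
  rewrite muleC integral_indic//; last exact: (@measurable_cube R n).
  rewrite setIT; congr (_ * _)%E.
  have := @integral_cube_cexp R n 0 1 (fun=> 0); rewrite Normc.normc0 => /(_ ler01).
  rewrite mul0rn addr0 mulr1 => <-.
  rewrite -[RHS]mul1e -integral_cst//; last exact: (@measurable_cube R n).
  by apply: eq_integral => t _; rewrite mul0r addr0.
rewrite E; apply: eq_integral => p _.
rewrite [RHS]integral_mkcond; apply: eq_integral => t _.
by rewrite epatch_indic.
Qed.

End tuple_rotation.

Section radial_product_integral.
Context {R : realType}.
Local Notation mu := (@lebesgue_measure R).
Local Notation MR := (measurableTypeR R).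
Local Notation mu2 := (sf_product mu mu).

Lemma normc_cpoint2 n (p : n.-tuple (MR * MR)) j :
  normc (Defs.cpoint p 0 j) ^+ 2 = (tnth p j).1 ^+ 2 + (tnth p j).2 ^+ 2.
Proof. by rewrite mxE normc2E. Qed.

Lemma hcoord_cpoint_tcons n x (t : n.+1.-tuple (MR * MR)) k :
  hcoord (Defs.cpoint (tcons (x, t))) k.+1 = hcoord (Defs.cpoint t) k.
Proof.
have [kn|nk] := ltnP k n.+1; last by rewrite /hcoord !insubF// ltnNge ?ltnS nk.
rewrite -[k]/(val (Ordinal kn)) hcoord_ord.
have -> : (Ordinal kn).+1 = lift ord0 (Ordinal kn) :> nat by [].
by rewrite hcoord_ord !mxE tnthS.
Qed.

(** The shape shared by all |e_a|^2 w: the squared prefactor times one profile [g j] per squared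
    ratio. *)
Definition radial_product n (g : nat -> R -> R) (p : n.+1.-tuple (MR * MR)) : R :=
  (\prod_(k < n) (normc (cr (Defs.cpoint p) k) ^+ 2)^-1) *
  \prod_(j < n.+1) g j (normc (hratio (Defs.cpoint p) j) ^+ 2).

Lemma radial_product0 g x (t : 0.-tuple (MR * MR)) :
  radial_product g (tcons (x, t)) = g 0%N (x.1 ^+ 2 + x.2 ^+ 2).
Proof.
rewrite /radial_product big_ord0 mul1r big_ord1.
by rewrite (_ : ord0 = ord_max) ?hratio_max ?normc_cpoint2//; exact/val_inj.
Qed.

(** The factor [q^-1] split off with the first coordinate is what cancels the factor [q] of the
    radial integral. *)
Lemma radial_product_tcons n g x (t : n.+1.-tuple (MR * MR)) :
  let q := (tnth t ord0).1 ^+ 2 + (tnth t ord0).2 ^+ 2 in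
  radial_product g (tcons (x, t)) =
  q^-1 * g 0%N ((x.1 ^+ 2 + x.2 ^+ 2) / q) * radial_product (g \o S) t.
Proof.
move=> q; rewrite /radial_product big_ord_recl [X in _ * X = _]big_ord_recl.
have c1 : hcoord (Defs.cpoint t) (ord0 : 'I_n.+1) = Defs.cpoint t 0 ord0 := hcoord_ord _ _.
have c2 : hcoord (Defs.cpoint t) (ord0 : 'I_n.+2) = Defs.cpoint t 0 ord0 :=
  hcoord_ord _ (ord0 : 'I_n.+1).
rewrite -!mulrA; congr (_ * _).
  by rewrite -hcoordS hcoord_cpoint_tcons c1 normc_cpoint2.
rewrite mulrCA; congr (_ * _).
  rewrite /hratio hcoord_cpoint_tcons Normc.normcM Normc.normcV exprMn exprVn normc_cpoint2.
  by rewrite c2 normc_cpoint2.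
congr (_ * _); apply: eq_bigr => k _.
  by rewrite -!hcoordS hcoord_cpoint_tcons.
by rewrite /hratio -!hcoord_ord !hcoord_cpoint_tcons.
Qed.

Lemma cmeasurable_hcoord n k (D : set (n.+1.-tuple (MR * MR))) :
  cmeasurable D (fun p => hcoord (Defs.cpoint p) k).
Proof.
rewrite /hcoord; case: insubP => [j _ _|_]; last exact: cmeasurable_cst.
under [X in cmeasurable _ X]eq_fun do rewrite /oapp mxE.
by apply: cmeasurable_complex; apply: measurable_funTS;
  exact: measurableT_comp (measurable_tnth j).
Qed.

Lemma cmeasurable_hratio n j (D : set (n.+1.-tuple (MR * MR))) :
  cmeasurable D (fun p => hratio (Defs.cpoint p) j).
Proof.
under [X in cmeasurable _ X]eq_fun do rewrite /hratio -hcoord_ord.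
apply: cmeasurableM; first exact: cmeasurable_hcoord.
by apply: cmeasurableV; exact: cmeasurable_hcoord.
Qed.

Lemma measurable_radial_product n g (D : set (n.+1.-tuple (MR * MR))) :
  (forall j, measurable_fun setT (g j)) ->
  measurable_fun D (radial_product g).
Proof.
move=> mg; apply: measurable_funM; apply: measurable_prod => j _.
  apply: measurable_funV; apply: measurable_normc2.
  under [X in cmeasurable _ X]eq_fun do rewrite -hcoordS.
  exact: cmeasurable_hcoord.
by apply: measurableT_comp (mg j) _; apply: measurable_normc2; exact: cmeasurable_hratio.
Qed.

Lemma radial_product_ge0 n g (p : n.+1.-tuple (MR * MR)) :
  (forall j s, 0 <= g j s) -> 0 <= radial_product g p.
Proof.
move=> g0; rewrite mulr_ge0//; apply: prodr_ge0 => j _ //.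
by rewrite invr_ge0 sqr_ge0.
Qed.

(* Where a coordinate vanishes, division by it gives junk ratios equal to 0; the
   hypothesis [g j.+1 0 = 0] makes the integrand vanish there. *)
Lemma integral_radial_product n (g : nat -> R -> R) (I : nat -> R) :
  (forall j, measurable_fun setT (g j)) -> (forall j s, 0 <= g j s) ->
  (forall j, g j.+1 0 = 0) ->
  (forall j, \int[mu]_(s in [set` `[0%R, +oo[]) (g j s)%:E = (I j)%:E)%E ->
  (\int[lebesgue_Cn R n.+1]_p (radial_product g p)%:E =
   (\prod_(j < n.+1) (pi * I j))%:E)%E.
Proof.
elim: n g I => [|n IH] g I mg g0 g00 gI.
  rewrite (integral_tuple_measure_head_tail mu2); last 2 first.
  - by apply/measurable_EFinP; exact: measurable_radial_product.
  - by move=> p; rewrite lee_fin radial_product_ge0.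
  transitivity (\int[mu2]_x (g 0%N (((x.1 : R) ^+ 2 + (x.2 : R) ^+ 2) / 1))%:E)%E.
    apply: eq_integral => x _; rewrite integral_dirac//; last first.
      have mR : measurable_fun setT (fun p : 1.-tuple (MR * MR) => (radial_product g p)%:E).
        by apply/measurable_EFinP; exact: measurable_radial_product.
      exact: measurableT_comp mR (measurableT_comp (@measurable_tcons _ _ 0) (pair1_measurable x)).
    by rewrite diracT mul1e radial_product0 divr1.
  have mg0 : measurable_fun setT (fun s : MR => (g 0%N s)%:E).
    by apply/measurable_EFinP; exact: mg.
  rewrite (ge0_integral_radial ltr01 mg0) => [|x]; last by rewrite lee_fin.
  by rewrite mulr1 gI big_ord1 EFinM.
(* The head is integrated first, with the tail fixed, because its ratio is scaled by the next
   coordinate. *)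
rewrite (integral_tuple_measure_tail_head mu2); last 2 first.
- by apply/measurable_EFinP; exact: measurable_radial_product.
- by move=> p; rewrite lee_fin radial_product_ge0.
have gI' j : (\int[mu]_(s in [set` `[0%R, +oo[]) ((g \o S) j s)%:E =
    ((I \o S) j)%:E)%E by exact: gI.
have gS0 j s : 0 <= (g \o S) j s by exact: g0.
have mgS j : measurable_fun setT ((g \o S) j) by exact: mg.
have gS00 j : (g \o S) j.+1 0 = 0 by exact: g00.
have I0 : 0 <= I 0%N by rewrite -lee_fin -gI; apply: integral_ge0 => s _; rewrite lee_fin.
transitivity (\int[lebesgue_Cn R n.+1]_t ((pi * I 0%N)%:E * (radial_product (g \o S) t)%:E))%E.
  apply: eq_integral => t _.
  have := radial_product_tcons g _ t; set q := _ + _ => /= E.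
  under eq_integral do rewrite E mulrAC EFinM.
  have q0 : 0 <= q by rewrite addr_ge0// sqr_ge0.
  have [qE|qn0] := eqVneq q 0.
    have r0 : radial_product (g \o S) t = 0.
      apply/eqP; rewrite mulf_eq0; apply/orP; right; apply/prodf_eq0; exists ord0 => //.
      rewrite /hratio Normc.normcM exprMn normc_cpoint2 -/q qE mul0r.
      by apply/eqP; exact: g00.
    by rewrite r0 mule0 integral0_eq// => x _; rewrite mulr0 mul0e.
  have qgt0 : 0 < q by rewrite lt_def qn0.
  have mg0 : measurable_fun setT (fun s : MR => (g 0%N s)%:E).
    by apply/measurable_EFinP; exact: mg.
  have rad := ge0_integral_radial qgt0 mg0 (fun s => g0 0%N s).
  rewrite ge0_integralZl//; last 3 first.
  - apply/measurable_EFinP; apply: measurableT_comp (mg 0%N) _.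
    by apply: measurable_funM; [exact: measurable_sqnorm|exact: measurable_cst].
  - by move=> x _; rewrite lee_fin.
  - by rewrite lee_fin mulr_ge0 ?invr_ge0// radial_product_ge0.
  rewrite rad gI -!EFinM; congr _%:E.
  by field.
rewrite ge0_integralZl//; last 3 first.
- by apply/measurable_EFinP; exact: measurable_radial_product.
- by move=> t _; rewrite lee_fin radial_product_ge0.
- by rewrite lee_fin mulr_ge0// pi_ge0.
by rewrite (IH _ _ mgS gS0 gS00 gI') -EFinM [in RHS]big_ord_recl.
Qed.

End radial_product_integral.

(** * The Bergman weight *)

Section bergman_weight.
Context {R : realType}.
Local Notation mu := (@lebesgue_measure R).
Local Notation MR := (measurableTypeR R).

Definition beta_density (b : bool) (M A : nat) : R -> R :=
  (fun s : R => (M - 1)%:R * (s ^+ A * (1 - s) ^+ (M - 2)) : R)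
  \_ (if b then `]0, 1[%classic else `[0, 1[%classic).

Lemma beta_densityE b M A (s : R) : (if b then 0 < s else 0 <= s) -> s < 1 ->
  beta_density b M A s = (M - 1)%:R * (s ^+ A * (1 - s) ^+ (M - 2)).
Proof.
by move=> s0 s1; rewrite /beta_density patchE mem_set//; case: b s0 => /= s0; rewrite in_itv/= s0.
Qed.

Lemma beta_density_ge1 b M A (s : R) : 1 <= s -> beta_density b M A s = 0.
Proof.
move=> s1; rewrite /beta_density patchE; case: ifPn => // /set_mem.
by case: b => /=; rewrite in_itv/= => /andP[_]; rewrite ltNge s1.
Qed.

Lemma beta_density0 M A : beta_density true M A 0 = 0.
Proof.
by rewrite /beta_density patchE; case: ifPn => //; rewrite inE /= in_itv/= ltxx.
Qed.

Lemma beta_density_ge0 b M A (s : R) : 0 <= beta_density b M A s.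
Proof.
rewrite /beta_density patchE; case: ifPn => // /set_mem sb.
have /andP[s0 s1] : 0 <= s <= 1.
  case: b sb => /=; rewrite in_itv/= => /andP[s0 s1]; rewrite (ltW s1) andbT//.
  exact: ltW.
by rewrite mulr_ge0// mulr_ge0// exprn_ge0// subr_ge0.
Qed.

Lemma measurable_beta_kernel M A (D : set MR) :
  measurable_fun D (fun s : R => (M - 1)%:R * (s ^+ A * (1 - s) ^+ (M - 2))).
Proof.
apply: measurable_funM; first exact: measurable_cst.
apply: measurable_funM; apply: measurable_funX => //.
by apply: measurable_funB => //; exact: measurable_cst.
Qed.

Lemma measurable_beta_density b M A : measurable_fun setT (beta_density b M A).
Proof.
apply/(@measurable_restrict _ _ MR MR _ setT).
- by case: b; exact: measurable_itv.
- by [].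
- by rewrite setTI; exact: measurable_beta_kernel.
Qed.

(** It is [M - 1] times the beta integral with parameters [A + 1] and [M - 1]. The value is the
    inverse of one factor of [coefc], which is why the weighted norms of the basis functions are
    1. *)
Lemma integral_beta_density b M A : (2 <= M)%N ->
  (\int[mu]_(s in [set` `[0%R, +oo[]) (beta_density b M A s)%:E =
   ('C(M.-1 + A, M.-1)%:R^-1)%:E)%E.
Proof.
case: M => [|[|M]]// _; pose k (s : R) := (M.+2 - 1)%:R * (s ^+ A * (1 - s) ^+ (M.+2 - 2)).
have mk (D : set MR) : measurable_fun D (fun s => (k s)%:E).
  by apply/measurable_EFinP; exact: measurable_beta_kernel.
transitivity (\int[mu]_(s in [set` `[0%R, 1%R]]) (k s)%:E)%E.
  transitivity (\int[mu]_(s in if b then `]0%R, 1%R[%classic else `[0%R, 1%R[%classic) (k s)%:E)%E.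
    rewrite integral_mkcond [RHS]integral_mkcond; apply: eq_integral => s _.
    rewrite !patchE /beta_density patchE -/(k s).
    case: ifPn => [_|/negP s0]; first by case: ifP.
    rewrite memNset// => sJ; apply: s0; rewrite inE/= in_itv/= andbT.
    by case: b sJ => /=; rewrite in_itv/= => /andP[]// /ltW.
  case: b; last by rewrite (integral_itv_bndo_bndc (mk _)).
  by rewrite (integral_itv_bndo_bndc (mk _)) (integral_itv_obnd_cbnd (mk _)).
transitivity ((M.+1%:R)%:E * (@beta_fun R A.+1 M.+1)%:E)%E.
  rewrite EFin_beta_fun integral_XMonemX_restrict setTI.
  rewrite -ge0_integralZl//.
  - by apply: eq_integral => s _; rewrite -EFinM /k !subSS !subn0.
  - by apply/measurable_EFinP; exact: measurable_XMonemX.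
  - by move=> s s01; rewrite lee_fin XMonemX_ge0.
rewrite beta_fun_fact -EFinM; congr _%:E.
have E := bin_fact (leq_addr A M.+1); rewrite addKn in E.
have -> : (A + M).+1`! = ('C(M.+1 + A, M.+1) * (M.+1`! * A`!))%N.
  by rewrite E addSn addnC.
have C0 : 'C(M.+1 + A, M.+1)%:R != 0 :> R by rewrite pnatr_eq0 -lt0n bin_gt0 leq_addr.
have A0 : A`!%:R != 0 :> R by rewrite pnatr_eq0 -lt0n fact_gt0.
have M0 : M`!%:R != 0 :> R by rewrite pnatr_eq0 -lt0n fact_gt0.
have M1 : M.+1%:R != 0 :> R by rewrite pnatr_eq0.
rewrite factS !natrM.
move: ('C(_, _)%:R) A`!%:R M`!%:R M.+1%:R C0 A0 M0 M1 => x y z w x0 y0 z0 w0.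
by field; rewrite x0 y0 z0 w0.
Qed.


Context (n : nat) (m : 'I_n.+1 -> nat) (a : {ffun 'I_n.+1 -> nat}).
Hypothesis m2 : forall j, (2 <= m j)%N.

Lemma hartogs_weightE (z : 'rV[R[i]]_n.+1) : hartogs_weight m z =
  (pi ^+ n.+1)^-1 *
  \prod_j ((m j - 1)%:R * (1 - normc (hratio z j) ^+ 2) ^+ (m j - 2)).
Proof.
rewrite /hartogs_weight -mulrA [in RHS]big_ord_recr/= hratio_max; congr (_ * (_ * _)).
by apply: eq_bigr => k _; rewrite hratio_cl Normc.normcM Normc.normcV exprMn exprVn.
Qed.

(* The origin is excluded for [0 < j] only: in the Hartogs triangle all
   coordinates but the first are nonzero. *)
Definition monom_density (j : nat) : R -> R :=
  beta_density (0 < j)%N (m (inord j)) (a (inord j)).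

Lemma monom_density_hartogs (p : n.+1.-tuple (MR * MR)) : hartogs R n (Defs.cpoint p) ->
  normc (monom a (Defs.cpoint p)) ^+ 2 * hartogs_weight m (Defs.cpoint p) =
  (pi ^+ n.+1)^-1 * radial_product monom_density p.
Proof.
move=> Dp; set z := Defs.cpoint p.
rewrite hartogs_weightE mulrCA; congr (_ * _).
rewrite /radial_product -/z /monom Normc.normcM Normc.normcV exprMn exprVn.
rewrite !normc_prod -prodrXl -prodfV -mulrA; congr (_ * _).
rewrite -prodrXl -big_split/=; apply: eq_bigr => j _.
rewrite /monom_density inord_val beta_densityE.
- by rewrite normcX mulrCA -!exprM mulnC.
- case: ifP => j0; last exact: sqr_ge0.
  rewrite exprn_gt0// normc_gt0 mulf_neq0// ?invr_eq0 ?hartogs_coord_neq0//.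
  rewrite -hcoord_ord -(prednK j0).
  have jn : (j.-1 < n.+1)%N by rewrite (leq_ltn_trans (leq_pred _)).
  exact: (hartogs_coord_neq0 (Ordinal jn) Dp).
- by rewrite expr_lt1 ?normc_ge0// hartogs_hratio_lt1.
Qed.

(** Some coordinate has modulus at least that of the next. If the next is nonzero, the ratio is at
    least 1 and its density vanishes; if it is zero, the prefactor is 0 by the convention on
    inverses. Integrals over the domain thus become integrals over the whole space. *)
Lemma monom_density_notin (p : n.+1.-tuple (MR * MR)) : ~ hartogs R n (Defs.cpoint p) ->
  radial_product monom_density p = 0.
Proof.
move=> nDp; set z := Defs.cpoint p.
have [j zj] : exists j : 'I_n.+1, normc (hcoord z j.+1) <= normc (hcoord z j).
  apply/not_existsP => h; apply/nDp/hartogsP => j.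
  by rewrite ltNge; apply/negP => /h.
have [zj0|zj0] := eqVneq (hcoord z j.+1) 0; last first.
  apply/eqP; rewrite mulf_eq0; apply/orP; right; apply/prodf_eq0; exists j => //.
  apply/eqP/beta_density_ge1; rewrite expr_ge1 ?normc_ge0//.
  rewrite -/z /hratio Normc.normcM Normc.normcV -hcoord_ord ler_pdivlMr ?mul1r//.
  by rewrite normc_gt0.
have jn : (j < n)%N.
  rewrite ltn_neqAle -ltnS ltn_ord andbT; apply/eqP => jn.
  by move: zj0; rewrite jn hcoord_max => /eqP; rewrite oner_eq0.
apply/eqP; rewrite mulf_eq0; apply/orP; left; apply/prodf_eq0; exists (Ordinal jn) => //.
by rewrite -hcoordS zj0 Normc.normc0 expr0n invr0.
Qed.

Lemma measurable_hartogs_preimage :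
  measurable (Defs.cpoint (n := n.+1) @^-1` hartogs R n).
Proof.
rewrite (_ : _ @^-1` _ = \bigcap_(j in [set: 'I_n.+1])
    ((fun p : n.+1.-tuple (MR * MR) => normc (hcoord (Defs.cpoint p) j.+1) -
       normc (hcoord (Defs.cpoint p) j) : MR) @^-1` `]0, +oo[%classic)); last first.
  apply/seteqP; split => p /=.
    by move=> /hartogsP h j _ /=; rewrite in_itv/= andbT subr_gt0.
  by move=> h; apply/hartogsP => j; have := h j I; rewrite /= in_itv/= andbT subr_gt0.
apply: fin_bigcap_measurable => // j _; rewrite -[X in measurable X]setTI.
apply: (measurable_funB (measurable_normc (cmeasurable_hcoord _ _))
  (measurable_normc (cmeasurable_hcoord _ _))) => //.
Qed.

Lemma integral_hbasis_weight :
  (\int[lebesgue_Cn R n.+1]_(p in Defs.cpoint (n := n.+1) @^-1` hartogs R n)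
    (normc (hbasis m a (Defs.cpoint p)) ^+ 2 * hartogs_weight m (Defs.cpoint p))%:E = 1)%E.
Proof.
have mg j : measurable_fun setT (monom_density j) by exact: measurable_beta_density.
have g0 j s : 0 <= monom_density j s by exact: beta_density_ge0.
have pin0 : 0 < (pi : R) ^+ n.+1 by rewrite exprn_gt0// pi_gt0.
transitivity (\int[lebesgue_Cn R n.+1]_p
  ((coefc m a / pi ^+ n.+1)%:E * (radial_product monom_density p)%:E))%E.
  rewrite integral_mkcond; apply: eq_integral => p _; rewrite patchE -EFinM.
  case: ifPn => [/set_mem Dp|/negP nDp]; last first.
    by rewrite monom_density_notin ?mulr0// => Dp; apply: nDp; exact/mem_set.
  congr _%:E; rewrite /hbasis Normc.normcM normc_real exprMn real_normK ?num_real//.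
  rewrite sqr_sqrtr ?(ltW (coefc_gt0 _ _))// -mulrA monom_density_hartogs//.
  by rewrite mulrA.
rewrite ge0_integralZl//; last 3 first.
- by apply/measurable_EFinP; exact: measurable_radial_product.
- by move=> p _; rewrite lee_fin radial_product_ge0.
- by rewrite lee_fin divr_ge0 ?(ltW pin0)// (ltW (coefc_gt0 _ _)).
rewrite (integral_radial_product n mg g0 _ (fun j => integral_beta_density _ _ (m2 _))); last first.
  by move=> j; exact: beta_density0.
rewrite big_split/= prodr_const card_ord prodfV -EFinM; congr _%:E.
under eq_bigr do rewrite inord_val.
by rewrite -/(coefc m a) mulrA mulfVK ?gt_eqF// mulfV// gt_eqF// coefc_gt0.
Qed.

End bergman_weight.

(** * The Bergman norm as a weighted L^2 norm *)

Section bergman_norm.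
Context {R : realType}.
Local Notation mu := (@lebesgue_measure R).
Local Notation MR := (measurableTypeR R).
Context (n : nat) (m : 'I_n.+1 -> nat).
Hypothesis m2 : forall j, (2 <= m j)%N.
Context (H : hartogs_space R n m) (f : H).
Variable c : {ffun 'I_n.+1 -> nat} -> R[i].
Hypothesis fc : forall z, hartogs R n z ->
  ccvg (fun N => \sum_(a <- box n.+1 N) c a * hbasis m a z) (rkhs_fun f z).
Hypothesis nc : sqsum (box n.+1 N) c @[N --> \oo] --> rkhs_norm f ^+ 2.

Local Notation D := (Defs.cpoint (n := n.+1) @^-1` hartogs R n).
Local Notation w p := (hartogs_weight m (Defs.cpoint p)).

Let m0 j : (0 < m j)%N. Proof. exact: leq_trans (m2 j). Qed.

Lemma cpoint_rotp (t : n.+1.-tuple MR) (p : n.+1.-tuple (MR * MR)) :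
  Defs.cpoint (rotp (tnth t) p) = trot t (Defs.cpoint p).
Proof.
apply/rowP => j; rewrite !mxE tnth_mktuple /plane_rotation/=.
by apply: complex_eqP; rewrite ?cReM ?cImM/=; ring.
Qed.

Lemma hartogs_weight_rotp (t : n.+1.-tuple MR) (p : n.+1.-tuple (MR * MR)) :
  w (rotp (tnth t) p) = w p.
Proof.
rewrite cpoint_rotp !hartogs_weightE; congr (_ * _); apply: eq_bigr => j _.
by rewrite /hratio -!hcoord_ord !Normc.normcM !Normc.normcV !normc_coord_rot.
Qed.

Lemma hartogs_weight_ge0 (p : n.+1.-tuple (MR * MR)) : D p -> 0 <= w p.
Proof.
move=> Dp; rewrite hartogs_weightE mulr_ge0 ?invr_ge0 ?exprn_ge0 ?pi_ge0//.
apply: prodr_ge0 => j _; rewrite mulr_ge0// exprn_ge0// subr_ge0.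
by rewrite expr_le1 ?normc_ge0// ltW// hartogs_hratio_lt1.
Qed.

Lemma measurable_hartogs_weight (E : set (n.+1.-tuple (MR * MR))) :
  measurable_fun E (fun p => w p).
Proof.
under eq_fun do rewrite hartogs_weightE.
apply: measurable_funM; first exact: measurable_cst.
apply: measurable_prod => j _; apply: measurable_funM; first exact: measurable_cst.
apply: measurable_funX; apply: measurable_funB; first exact: measurable_cst.
by apply: measurable_normc2; exact: cmeasurable_hratio.
Qed.

Lemma cmeasurable_hbasis a (E : set (n.+1.-tuple (MR * MR))) :
  cmeasurable E (fun p => hbasis m a (Defs.cpoint p)).
Proof.
apply: cmeasurableM; first exact: cmeasurable_cst.
apply: cmeasurableM; last first.
  by apply: cmeasurable_prod => j; apply: cmeasurableX; exact: cmeasurable_hratio.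
apply: cmeasurableV; apply: cmeasurable_prod => k.
under [X in cmeasurable _ X]eq_fun do rewrite -hcoordS.
exact: cmeasurable_hcoord.
Qed.

Lemma cmeasurable_rkhs_fun : cmeasurable D (fun p => rkhs_fun f (Defs.cpoint p)).
Proof.
apply: (@cmeasurable_cvg _ _ _ _
  (fun N p => \sum_(a <- box n.+1 N) c a * hbasis m a (Defs.cpoint p))).
  move=> N; apply: cmeasurable_sum => a.
  exact: cmeasurableM (cmeasurable_cst _ _) (cmeasurable_hbasis _ _).
by move=> p Dp; exact: fc.
Qed.

Let mD := @measurable_hartogs_preimage R n.

(** Extended by 0 off the domain, so that averaging over circles applies on the whole space. *)
Let G (p : n.+1.-tuple (MR * MR)) : \bar R :=
  ((fun p => (normc (rkhs_fun f (Defs.cpoint p)) ^+ 2 * w p)%:E) \_ D) p.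

Let mG : measurable_fun setT G.
Proof.
apply/(@measurable_restrict _ _ _ _ _ setT _ mD) => //; rewrite setTI.
apply/measurable_EFinP; apply: measurable_funM; last exact: measurable_hartogs_weight.
by apply: measurable_normc2; exact: cmeasurable_rkhs_fun.
Qed.

Let G0 p : (0 <= G p)%E.
Proof.
rewrite /G patchE; case: ifPn => // /set_mem Dp.
by rewrite lee_fin mulr_ge0 ?sqr_ge0// hartogs_weight_ge0.
Qed.

(** The integral over the angle cube of the squared partial sum times the weight, as given by
    Parseval: no cross terms remain, so it increases with [N]. *)
Let S N (p : n.+1.-tuple (MR * MR)) : R :=
  (2 * pi) ^+ n.+1 *
  \sum_(a <- box n.+1 N) normc (c a) ^+ 2 * (normc (hbasis m a (Defs.cpoint p)) ^+ 2 * w p).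

Let pi20 : 0 <= (2 * pi : R) ^+ n.+1.
Proof. by rewrite exprn_ge0// mulr_ge0// pi_ge0. Qed.

Let circle_average_cvg p : D p -> (S N p)%:E @[N --> \oo] -->
  (\int[lebesgue_Rn R n.+1]_(t in @cube R n.+1) G (rotp (tnth t) p))%E.
Proof.
move=> Dp; pose F t := (normc (rkhs_fun f (trot t (Defs.cpoint p))) ^+ 2)%:E.
have -> : (\int[lebesgue_Rn R n.+1]_(t in @cube R n.+1) G (rotp (tnth t) p) =
    (w p)%:E * \int[lebesgue_Rn R n.+1]_(t in @cube R n.+1) F t)%E.
  rewrite -ge0_integralZl//.
  - apply: eq_integral => t _; rewrite /G patchE mem_set; last first.
      by rewrite /= cpoint_rotp; exact/hartogs_rot.
    by rewrite hartogs_weight_rotp cpoint_rotp -EFinM mulrC.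
  - exact: (@measurable_cube R n.+1).
  - by apply/measurable_EFinP/measurable_normc2; exact: (cmeasurable_rot fc).
  - by move=> t _; rewrite lee_fin sqr_ge0.
  - by rewrite lee_fin hartogs_weight_ge0.
have := torus_mean_square_cvg m0 fc nc Dp.
move=> /(cvgeZl (_ : _ \is a fin_num)) => /(_ (w p)%:E isT).
apply: cvg_trans; apply: near_eq_cvg; apply: nearW => N.
rewrite -EFinM /S mulrCA; congr (_ * _)%:E; rewrite /sqsum mulr_sumr.
by apply: eq_bigr => a _; rewrite Normc.normcM exprMn mulrCA [w p * _]mulrC.
Qed.

Let integral_S N : (\int[lebesgue_Cn R n.+1]_(p in D) (S N p)%:E =
  ((2 * pi) ^+ n.+1 * sqsum (box n.+1 N) c)%:E)%E.
Proof.
have mb a : measurable_fun D (fun p => normc (hbasis m a (Defs.cpoint p)) ^+ 2 * w p).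
  apply: measurable_funM; last exact: measurable_hartogs_weight.
  by apply: measurable_normc2; exact: cmeasurable_hbasis.
have b0 a p : D p -> 0 <= normc (hbasis m a (Defs.cpoint p)) ^+ 2 * w p.
  by move=> Dp; rewrite mulr_ge0 ?sqr_ge0// hartogs_weight_ge0.
under eq_integral do rewrite /S EFinM.
rewrite ge0_integralZl//; last 2 first.
- apply/measurable_EFinP; apply: measurable_sum => a.
  by apply: measurable_funM => //; exact: measurable_cst.
- by move=> p Dp; rewrite lee_fin; apply: sumr_ge0 => a _; rewrite mulr_ge0 ?sqr_ge0// b0.
under eq_integral do rewrite -sumEFin.
rewrite ge0_integral_sum//; last 2 first.
- by move=> a; apply/measurable_EFinP; apply: measurable_funM => //; exact: measurable_cst.
- by move=> a p Dp; rewrite lee_fin mulr_ge0 ?sqr_ge0// b0.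
rewrite EFinM /sqsum -sumEFin; congr (_ * _)%E; apply: eq_bigr => a _.
under eq_integral do rewrite EFinM.
rewrite ge0_integralZl//; last 3 first.
- by apply/measurable_EFinP.
- by move=> p Dp; rewrite lee_fin b0.
- by rewrite lee_fin sqr_ge0.
by rewrite integral_hbasis_weight// mule1.
Qed.

(** Monotone convergence evaluates the integral of the circle averages as the limit of the integrals
    of [S N], namely (2 pi)^(n+1) times the squared norm; the averaging identity carries the same
    factor, which cancels. *)
Lemma bergman_norm_integral :
  (\int[lebesgue_Cn R n.+1]_(p in D) (normc (rkhs_fun f (Defs.cpoint p)) ^+ 2 * w p)%:E =
  (rkhs_norm f ^+ 2)%:E)%E.
Proof.
have pin0 : (2 * pi : R) ^+ n.+1 != 0.
  by rewrite expf_neq0// mulf_neq0 ?gt_eqF ?pi_gt0.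
have [mSN S0] : (forall N, measurable_fun D (fun p => (S N p)%:E)) /\
    (forall N p, D p -> (0 <= (S N p)%:E)%E).
  split=> [N|N p Dp].
    apply/measurable_EFinP; apply: measurable_funM; first exact: measurable_cst.
    apply: measurable_sum => a; apply: measurable_funM; first exact: measurable_cst.
    apply: measurable_funM; last exact: measurable_hartogs_weight.
    by apply: measurable_normc2; exact: cmeasurable_hbasis.
  rewrite lee_fin mulr_ge0//; apply: sumr_ge0 => a _.
  by rewrite mulr_ge0 ?sqr_ge0// mulr_ge0 ?sqr_ge0// hartogs_weight_ge0.
have ndS p : D p -> nondecreasing_seq (fun N => (S N p)%:E).
  move=> Dp N M NM; rewrite lee_fin ler_wpM2l//; apply: ler_sum_subset => *.
  - exact: box_uniq.
  - exact: box_uniq.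
  - exact: box_sub.
  by rewrite mulr_ge0 ?sqr_ge0// mulr_ge0 ?sqr_ge0// hartogs_weight_ge0.
have cvg1 := @cvg_monotone_convergence _ _ _ (lebesgue_Cn R n.+1) _ mD _ mSN S0 ndS.
have cvg2 : (\int[lebesgue_Cn R n.+1]_(p in D) (S N p)%:E)%E @[N --> \oo] -->
    ((2 * pi) ^+ n.+1 * rkhs_norm f ^+ 2)%:E.
  under eq_fun do rewrite integral_S.
  by apply: cvg_EFin; [exact: nearW|exact: cvgMr].
have := integral_circle_average mG G0.
have -> : (\int[lebesgue_Cn R n.+1]_p
    \int[lebesgue_Rn R n.+1]_(t in @cube R n.+1) G (rotp (tnth t) p) =
    \int[lebesgue_Cn R n.+1]_(p in D) limn (fun N => (S N p)%:E))%E.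
  rewrite [RHS]integral_mkcond; apply: eq_integral => p _; rewrite patchE.
  case: ifPn => [/set_mem Dp|/negP nDp].
    by apply/esym/cvg_lim => //; exact: circle_average_cvg.
  (* A rotated point lies in the domain only if the point itself does, so off the domain the average
     is 0. *)
  apply: integral0_eq => t _; rewrite /G patchE memNset//= cpoint_rotp => /hartogs_rot Dp.
  by apply: nDp; exact/mem_set.
rewrite (cvg_unique _ cvg1 cvg2)// => E.
rewrite integral_mkcond -[LHS]/(\int[lebesgue_Cn R n.+1]_p G p)%E.
have := congr1 (fun x => (((2 * pi) ^+ n.+1)^-1%:E * x)%E) E.
by rewrite muleA -!EFinM mulVf// mul1e mulKf.
Qed.

Theorem bergman_norm : L2_mem (hartogs R n) (hartogs_weight m) (rkhs_fun f) /\
  L2_norm (hartogs R n) (hartogs_weight m) (rkhs_fun f) = rkhs_norm f.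
Proof.
have [mr mi] := cmeasurable_rkhs_fun.
have E : L2_int (hartogs R n) (hartogs_weight m) (rkhs_fun f) = (rkhs_norm f ^+ 2)%:E.
  exact: bergman_norm_integral.
split; first by split => //; rewrite E ltry.
by rewrite /L2_norm E /= sqrtr_sqr ger0_norm// dot_norm_ge0.
Qed.

End bergman_norm.

Theorem proposition7p5 (R : realType) (n : nat) (n_ge2 : (2 <= n.+1)%N) :
  (forall (H : hartogs_space R n (fun=> 1%N)) (f : H),
     (rkhs_norm f ^+ 2)%:E =
     ereal_sup [set torus_mean (rkhs_fun f) t |
                 t in [set t : 'I_n.+1 -> R | forall j, 0 < t j < 1]])
  /\
  (forall m : 'I_n.+1 -> nat, (forall j, (2 <= m j)%N) ->
     forall (H : hartogs_space R n m) (f : H),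
       L2_mem (hartogs R n) (hartogs_weight m) (rkhs_fun f) /\
       L2_norm (hartogs R n) (hartogs_weight m) (rkhs_fun f) = rkhs_norm f).
Proof.
split=> [H f|m m2 H f]; first exact: hardy_norm_torus.
have [c [fc nc]] := rkhs_expansion (@box_uniq n.+1) (@box_sub n.+1)
  (hartogs_kernel_expansion (fun j => ltnW (m2 j))) f.
exact: (@bergman_norm R n m m2 H f c fc nc).
Qed.
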